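(* Let $K$ be a number field, $q,\xi,\alpha_1,\dots,\alpha_m\in K^*$ and $\beta_0,\dots,\beta_m\in K$. Assume $q$ is not a root of unity and that the classes of $\alpha_1,\dots,\alpha_m$ in $K^*/q^{\mathbb{Z}}$ are pairwise distinct. If for every place $v$ of $K$ (finite or infinite) with $|q|_v>1$ the $v$-adic entire function $\beta_0+\beta_1T_q(\alpha_1z)+\dots+\beta_mT_q(\alpha_mz)$ vanishes at $z=\xi$, then $\beta_0=\beta_1=\dots=\beta_m=0$.
   Context: $T_q(z)=\sum_{n\ge0}q^{-n(n-1)/2}z^n$ (Tschakaloff function). At a place $v$ with $|q|_v>1$ this series converges for all $z$ in the completion $\mathbb{C}_v$ of an algebraic closure of $K_v$. *)

(* Defs.v *)
From HB Require Import structures.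
From mathcomp Require Import all_boot all_order all_algebra all_field.
From mathcomp Require Import all_classical all_reals all_analysis.
Set Implicit Arguments. Unset Strict Implicit. Unset Printing Implicit Defensive.
Import Order.TTheory GRing.Theory Num.Theory.
Local Open Scope ring_scope.

Definition absolute_value (K : fieldType) (R : realType) (v : K -> R) : Prop :=
  [/\ forall x : K, 0 <= v x,
      forall x : K, (v x == 0) = (x == 0),
      forall x y : K, v (x * y) = v x * v y
    & forall x y : K, v (x + y) <= v x + v y].

(* A place of K, represented by any nontrivial absolute value on K
   (all conditions used below are invariant under equivalence of
   absolute values). *)
Definition place_rep (K : fieldType) (R : realType) (v : K -> R) : Prop :=
  absolute_value v /\ exists x : K, v x != 0 /\ v x != 1.

(* Partial sums of the Tschakaloff series
   T_q(z) = \sum_{n >= 0} q^{-n(n-1)/2} z^n ;  note 'C(n,2) = n(n-1)/2. *)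
Definition tschakaloff_partial (K : fieldType) (q z : K) (N : nat) : K :=
  \sum_(n < N) (q ^+ 'C(n, 2))^-1 * z ^+ n.

Definition tsch_comb_partial (K : fieldType) (m : nat) (q : K)
  (beta0 : K) (beta alpha : 'I_m -> K) (z : K) (N : nat) : K :=
  beta0 + \sum_(i < m) beta i * tschakaloff_partial q (alpha i * z) N.

(* Main.v *)
(* Put w(N) = D^(N+1) q^(N(N-1)/2) S(N), where S(N) is the N-th partial sum of the linear form
   and D clears denominators; then w(N+1) = D q^N (w(N) + sum_i b_i A_i^N).  Convergence of S(N)
   to 0 at the places with |q| > 1 makes w(N) integral with conjugates O(C^N).  Modulo
   a = 1 + q^k, k = 2^s, the coefficients of this recurrence are 2k-periodic, which makes the
   Hankel determinant H_M of w divisible by a power of a of exponent about M^2/k.  Since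
   1 + q^(2^s) and 1 + q^(2^t) are coprime up to 2, using many exponents s at once contradicts
   the Liouville inequality at a place with |q| > 1, unless H_M = 0.  Hence w satisfies a linear
   recurrence with constant coefficients; comparing the roots of the minimal one with those
   obtained through the q-recurrence, along the classes A_i q^Z, forces every b_i to vanish. *)
Require Import Defs.
From HB Require Import structures.
From mathcomp Require Import all_boot all_order all_algebra all_field.
From mathcomp Require Import all_classical all_reals all_analysis.
From mathcomp Require Import complex perm ring lra zify.
Set Implicit Arguments. Unset Strict Implicit. Unset Printing Implicit Defensive.
Import Order.TTheory GRing.Theory Num.Theory.
Import numFieldNormedType.Exports.
Local Open Scope classical_set_scope.
Local Open Scope ring_scope.

(** * Constant-coefficient recurrences *)

(** The gain from one exponent [s] does not depend on [s]: the power of [1 + q^(2^s)] dividing the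
    determinant decreases like 2^-s, while its size at the chosen place is about |q|^(2^s). One
    exponent yields a fixed constant to the power M^2, which the trivial bound of the conjugates,
    also a constant to the power M^2, may beat; [L] exponents multiply the gain by [L]. Two losses
    must not grow with [L]: the powers of 2 by which the factors fail to be coprime, and the
    conjugates of [1 + q^(2^s)] that come close to 0. Both are exponential in the sum of the
    multiplicities, which is a small multiple of M^2 once every [s] is large. Places are
    constructed, not given. A non-integral element yields a discrete one by Chevalley's argument,
    with lower bounds at rational integers that are uniform in the place; archimedean ones are
    embeddings into the complex numbers. The product formula is replaced by the fact that a nonzero
    integral element divides its norm, a nonzero integer. *)

Section Act.
Variable K : fieldType.
Implicit Types (P Q : {poly K}) (h w : nat -> K).

(** The [K[X]]-module structure on sequences in which ['X] is the shift: recurrences of [h] are its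
    annihilators. *)
Definition act P h (N : nat) : K := \sum_(j < size P) P`_j * h (N + j)%N.

Lemma act_widen P h N n : (size P <= n)%N ->
  act P h N = \sum_(j < n) P`_j * h (N + j)%N.
Proof.
move=> le; rewrite /act (big_ord_widen n (fun j => P`_j * h (N + j)%N)) // big_mkcond /=.
by apply: eq_bigr => j _; case: ltnP => // s; rewrite nth_default ?mul0r.
Qed.

Lemma actD P Q h N : act (P + Q) h N = act P h N + act Q h N.
Proof.
pose n := (size P + size Q + size (P + Q)%R)%N.
rewrite (@act_widen (P + Q) h N n) ?(@act_widen P h N n) ?(@act_widen Q h N n); try by rewrite /n; lia.
by rewrite -big_split /=; apply: eq_bigr => j _; rewrite coefD mulrDl.
Qed.

Lemma actZ c P h N : act (c *: P) h N = c * act P h N.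
Proof.
rewrite (@act_widen (c *: P) h N (size P)) ?size_scale_leq // /act mulr_sumr.
by apply: eq_bigr => j _; rewrite coefZ mulrA.
Qed.

Lemma actC c h N : act c%:P h N = c * h N.
Proof. by rewrite (@act_widen _ h N 1) ?size_polyC_leq1 // big_ord1 coefC /= addn0. Qed.

Lemma act0 h N : act 0 h N = 0.
Proof. by rewrite actC mul0r. Qed.

Lemma actMX P h N : act (P * 'X) h N = act P h N.+1.
Proof.
rewrite (@act_widen _ h N (size P).+1); last first.
  by have [->|nz] := eqVneq P 0; rewrite ?mul0r ?size_poly0 // size_mulX.
rewrite big_ord_recl coefMX /= mul0r add0r.
by apply: eq_bigr => j _; rewrite coefMX /= addSn addnS.
Qed.

Lemma act_mul P Q h N : act (P * Q) h N = act P (act Q h) N.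
Proof.
elim/poly_ind: P N => [|P c IH] N; first by rewrite mul0r !act0.
rewrite mulrDl !actD mul_polyC actZ actC; congr (_ + _).
by rewrite -mulrA ['X * Q]mulrC mulrA !actMX IH.
Qed.

Lemma act_sumf (I : Type) (r : seq I) P (h : I -> nat -> K) N :
  act P (fun n => \sum_(i <- r) h i n) N = \sum_(i <- r) act P (h i) N.
Proof. by rewrite /act exchange_big /=; apply: eq_bigr => j _; rewrite mulr_sumr. Qed.

Lemma act_addf P g h N : act P (fun n => g n + h n) N = act P g N + act P h N.
Proof. by rewrite /act -big_split /=; apply: eq_bigr => j _; rewrite mulrDr. Qed.

Lemma act_geom P c l N : act P (fun n => c * l ^+ n) N = c * P.[l] * l ^+ N.
Proof.
rewrite /act horner_coef mulr_sumr mulr_suml; apply: eq_bigr => j _.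
by rewrite exprD; ring.
Qed.

(** Conjugating the shift by [c ^+ n] scales it by [c]; for [c = q] this turns the factor [q ^+ N]
    of the q-recurrence into the substitution of [q *: 'X]. *)
Lemma act_scale P (c : K) h N :
  c ^+ N * act (P \Po (c *: 'X)) h N = act P (fun n => c ^+ n * h n) N.
Proof.
elim/poly_ind: P N => [|P a IH] N; first by rewrite comp_poly0 !act0 mulr0.
rewrite comp_poly_MXaddC !actD !actC mulrDr actMX -IH -scalerAr actZ actMX exprS.
by congr (_ + _); ring.
Qed.

(* A [P] of least size killing the first [M] indices kills one more index: compare [P P'] applied
   in both orders at the index [M - deg P'], for a [P'] killing the first [M + 1] indices. *)
Lemma recurrence_of_local (M0 : nat) w :
  (forall M, (M0 <= M)%N -> exists P, [/\ P != 0, (size P <= M)%N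
      & forall i, (i < M)%N -> act P w i = 0]) ->
  exists2 P, P != 0 & forall i, act P w i = 0.
Proof.
move=> H.
pose good n := `[< exists P, [/\ P != 0, (size P <= M0)%N, size P = n
      & forall i, (i < M0)%N -> act P w i = 0] >].
have ex0 : exists n, good n.
  have [P [nz s k]] := H M0 (leqnn _); exists (size P).
  by apply/asboolP; exists P.
case: (ex_minnP ex0) => n /asboolP[P [nzP sP nP kP]] minP.
exists P => // .
suff all k : (forall i, (i < M0 + k)%N -> act P w i = 0) /\
   (forall Q, Q != 0 -> (size Q <= M0 + k)%N ->
      (forall i, (i < M0 + k)%N -> act Q w i = 0) -> (size P <= size Q)%N).
  by move=> i; apply: (all i.+1).1; lia.
elim: k => [|k [IH1 IH2]].
  rewrite addn0; split=> // Q nzQ sQ kQ.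
  by rewrite nP; apply: minP; apply/asboolP; exists Q.
rewrite addnS; set M := (M0 + k)%N in IH1 IH2 *.
have next : act P w M = 0.
  have [Q [nzQ sQ kQ]] := H M.+1 ltac:(rewrite /M; lia).
  have PQ : (size P <= size Q)%N.
    have [le|lt] := leqP (size Q) M; last by rewrite /M in lt *; lia.
    by apply: IH2 => // i iM; apply: kQ; rewrite ltnS ltnW.
  have posQ : (0 < size Q)%N by rewrite lt0n size_poly_eq0.
  have posP : (0 < size P)%N by rewrite lt0n size_poly_eq0.
  pose i := (M.+1 - size Q)%N.
  have E1 : act P (act Q w) i = 0.
    rewrite /act big1 // => j _; rewrite -/(act Q w (i + j)%N) kQ ?mulr0 //.
    by have := ltn_ord j; rewrite /i; lia.
  have E2 : act Q (act P w) i = lead_coef Q * act P w M.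
    rewrite {1}/act; case E : (size Q) posQ => [//|s] _.
    rewrite big_ord_recr /= big1 ?add0r; last first.
      move=> j _; rewrite IH1 ?mulr0 //.
      by have := ltn_ord j; rewrite /i; lia.
    by rewrite lead_coefE E /=; congr (_ * act P w _); rewrite /i; lia.
  move: E1; rewrite -act_mul mulrC act_mul E2 => /eqP.
  by rewrite mulf_eq0 lead_coef_eq0 (negPf nzQ) /= => /eqP.
split=> [i|Q nzQ sQ kQ].
  by rewrite ltnS leq_eqVlt => /predU1P[->|/IH1].
have [le|lt] := leqP (size Q) M; last by rewrite /M in lt *; lia.
by apply: IH2 => // i iM; apply: kQ; rewrite ltnS ltnW.
Qed.

(** Kronecker's rationality criterion: a kernel vector of the Hankel matrix is the coefficient
    vector of a polynomial killing the first [M] indices. *)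
Lemma recurrence_of_hankel (M0 : nat) w :
  (forall M, (M0 <= M)%N -> \det (\matrix_(i < M, j < M) w (i + j)%N) = 0) ->
  exists2 P, P != 0 & forall i, act P w i = 0.
Proof.
move=> H; apply: (@recurrence_of_local M0) => M le.
have /eqP/det0P[v nz vH] := H M le.
exists (rVpoly v); split.
- by apply: contraNneq nz => z; rewrite -[v]rVpolyK z linear0.
- exact: size_poly.
move=> i iM; rewrite (@act_widen _ _ _ M) ?size_poly //.
move/rowP: vH => /(_ (Ordinal iM)); rewrite !mxE => E; rewrite -[RHS]E.
apply: eq_bigr => j _; rewrite coef_rVpoly_ord mxE /= addnC; congr (_ * w _); lia.
Qed.

(** The Hankel determinants only control a tail of the sequence. Eventual annihilators still form an
    ideal, generated by the polynomial of [ekill_minimal]. *)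
Definition ekill P h := exists N1, forall N, (N1 <= N)%N -> act P h N = 0.

Lemma ekillMl P Q h : ekill Q h -> ekill (P * Q) h.
Proof.
case=> N1 H; exists N1 => N le; rewrite act_mul /act big1 // => j _.
by rewrite -/(act Q h _) H ?mulr0 //; lia.
Qed.

Lemma ekill_addf P g h : ekill P g -> ekill P h -> ekill P (fun n => g n + h n).
Proof.
move=> [N1 H1] [N2 H2]; exists (N1 + N2)%N => N le.
by rewrite act_addf H1 ?H2 ?addr0 //; lia.
Qed.

Lemma ekill_oppf P h : ekill P h -> ekill P (fun n => - h n).
Proof.
case=> N1 H; exists N1 => N le; apply/eqP; rewrite -oppr_eq0 -(H N le) /act -sumrN; apply/eqP.
by apply: eq_bigr => j _; rewrite mulrN opprK.
Qed.

Lemma eq_ekill P g h N0 : (forall N, (N0 <= N)%N -> g N = h N) -> ekill P g -> ekill P h.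
Proof.
move=> E [N1 H]; exists (N1 + N0)%N => N le; rewrite -(H N); last by lia.
by apply: eq_bigr => j _; rewrite E //; lia.
Qed.

Lemma ekill_minimal w : (exists2 P, P != 0 & ekill P w) ->
  exists P, [/\ P != 0, ekill P w & forall Q, ekill Q w -> P %| Q].
Proof.
move=> [P0 nz0 k0].
pose good n := `[< exists P, [/\ P != 0, size P = n & ekill P w] >].
have ex0 : exists n, good n by exists (size P0); apply/asboolP; exists P0.
case: (ex_minnP ex0) => n /asboolP[P [nzP nP kP]] minP; exists P; split=> // Q kQ.
rewrite /dvdp; apply: contraT => nz.
have : (size P <= size (Q %% P)%R)%N.
  rewrite nP; apply: minP; apply/asboolP; exists (Q %% P); split=> //.
  have [N1 H1] := kQ; have [N2 H2] := @ekillMl (Q %/ P) P w kP.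
  exists (N1 + N2)%N => N le; have := H1 N ltac:(lia).
  by rewrite {1}(divp_eq Q P) actD H2 ?add0r //; lia.
by rewrite leqNgt ltn_modp nzP.
Qed.

(** The product of the ['X - A j] over [j != i] kills every term but the [i]-th. *)
Lemma geom_indep (m : nat) (A c : 'I_m -> K) N1 :
  injective A -> (forall i, A i != 0) ->
  (forall N, (N1 <= N)%N -> \sum_i c i * A i ^+ N = 0) -> forall i, c i = 0.
Proof.
move=> injA nzA H i.
pose P := \prod_(j | j != i) ('X - (A j)%:P).
have E : act P (fun n => \sum_j c j * A j ^+ n) N1 = 0.
  by rewrite /act big1 // => j _; rewrite H ?mulr0 //; lia.
move: E; rewrite act_sumf (bigD1 i) //= big1 ?addr0 => [|j ji]; last first.
  by rewrite act_geom /P horner_prod (bigD1 j) //= hornerXsubC subrr !(mul0r, mulr0).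
rewrite act_geom => /eqP; rewrite !mulf_eq0 expf_eq0 (negPf (nzA i)) andbF orbF.
case/orP => [/eqP//|]; rewrite /P horner_prod => /prodf_eq0[j ji].
by rewrite !hornerE subr_eq0 => /eqP/injA e; rewrite e eqxx in ji.
Qed.

End Act.

Lemma exprn_nonroot_inj (K : fieldType) (q : K) : q != 0 ->
  (forall n : nat, (0 < n)%N -> q ^+ n != 1) -> injective (fun k : nat => q ^+ k).
Proof.
move=> q0 qroot i j /= E; wlog le : i j E / (i <= j)%N.
  by move=> H; case: (leqP i j) => [|/ltnW] /H; [apply|move/(_ (esym E))].
apply/eqP; rewrite eqn_leq le /= leqNgt -subn_gt0; apply/negP => pos.
have /eqP := E; rewrite -(subnKC le) exprD -[X in X == _]mulr1 => /eqP.
move/(mulfI (expf_neq0 _ q0)) => e.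
by have := qroot _ pos; rewrite -e eqxx.
Qed.

(** * Sequences satisfying both a q-recurrence and a constant-coefficient recurrence *)

Section QRec.
Variables (K : fieldType) (q D : K) (m : nat) (A b : 'I_m -> K) (w : nat -> K) (N0 : nat).
Hypotheses (q0 : q != 0) (D0 : D != 0) (A0 : forall i, A i != 0).
Hypothesis qroot : forall n : nat, (0 < n)%N -> q ^+ n != 1.
Hypothesis Aclass : forall i j, i != j -> forall k : int, A i != A j * q ^ k.
Hypothesis wrec : forall N, (N0 <= N)%N ->
  w N.+1 = D * q ^+ N * (w N + \sum_i b i * A i ^+ N).

Let f N := w N + \sum_i b i * A i ^+ N.

Let Pi : {poly K} := \prod_i ('X - (A i)%:P).

Let PiE l : Pi.[l] = \prod_i (l - A i).
Proof. by rewrite horner_prod; apply: eq_bigr => i _; rewrite !hornerE. Qed.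

(** The recurrence says that [f N] is [w N.+1] divided by [D * q ^+ N], so annihilators of [w] and
    of [f] correspond under scaling the variable by [q], while [Pi] kills [f - w]. Away from the
    [A i], the roots of the minimal [P] are therefore stable under multiplication and division by
    [q]; being finite in number, they avoid all [A i] and [q * A i]. *)
Lemma qrec_rational : (exists2 P, P != 0 & ekill P w) -> forall i, b i = 0.
Proof.
move=> /ekill_minimal[P [nzP kP minP]].
have expq_inj := exprn_nonroot_inj q0 qroot.
have killPi : ekill Pi (fun N => \sum_i b i * A i ^+ N).
  exists 0%N => N _; rewrite act_sumf big1 // => i _.
  by rewrite act_geom PiE (bigD1 i) //= subrr mul0r mulr0 mul0r.
have fE N : (N0 <= N)%N -> f N = D^-1 * (q ^+ N)^-1 * w N.+1.
  by move=> le; rewrite wrec // /f; field; rewrite D0 expf_neq0.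
have killQ : ekill (P \Po (q *: 'X)) f.
  have [N1 H] := kP; exists (N1 + N0)%N => N le.
  apply: (mulfI (expf_neq0 N q0)); rewrite act_scale mulr0.
  transitivity (D^-1 * act P w N.+1); last by rewrite H ?mulr0 //; lia.
  rewrite /act mulr_sumr; apply: eq_bigr => j _; rewrite fE ?addSn; last by lia.
  by field; rewrite D0 expf_neq0.
have kf : ekill (P * Pi) f.
  by apply: ekill_addf; [rewrite mulrC|]; apply: ekillMl.
have kw : ekill ((P \Po (q *: 'X)) * Pi) w.
  apply: (@eq_ekill _ _ (fun N => f N + - \sum_i b i * A i ^+ N) _ 0%N) => [N _|].
    by rewrite /f addrK.
  apply: ekill_addf; first by rewrite mulrC; apply: ekillMl.
  exact/ekill_oppf/ekillMl.
have kE : ekill ((P * Pi) \Po (q^-1 *: 'X)) w.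
  have [N1 H] := kf; exists (N1 + N0).+1%N => [[//|N]] le.
  rewrite -actMX; apply: (mulfI (expf_neq0 N (invr_neq0 q0))); rewrite mulr0.
  apply: (mulfI (invr_neq0 D0)); rewrite mulr0.
  rewrite actMX -[RHS](H N); last by lia.
  transitivity (D^-1 * (q^-1 ^+ N * act ((P * Pi) \Po (q^-1 *: 'X)) (fun n => w n.+1) N)).
    by congr (_ * (_ * _)).
  rewrite act_scale /act mulr_sumr; apply: eq_bigr => j _.
  rewrite fE; last by lia.
  by rewrite exprVn; ring.
(* [P] divides [(P \Po (q *: 'X)) * Pi] and [(P * Pi) \Po (q^-1 *: 'X)]; each divisibility gives one
   implication. *)
have rootE (l : K) : (forall i, l != A i) -> root P l = root P (q * l).
  move=> nA.
  have nPi : Pi.[l] != 0 by rewrite PiE; apply/prodf_neq0 => i _; rewrite subr_eq0.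
  apply/idP/idP => r.
    have := dvdp_trans (_ : 'X - l%:P %| P) (minP _ kw); rewrite !dvdp_XsubCl => /(_ r).
    rewrite rootM [X in _ || X]/root (negPf nPi) orbF /root horner_comp !hornerE //.
  have := dvdp_trans (_ : 'X - (q * l)%:P %| P) (minP _ kE); rewrite !dvdp_XsubCl => /(_ r).
  by rewrite /root horner_comp hornerZ hornerX mulKf // hornerM mulf_eq0 (negPf nPi) orbF.
have nroots (l : K) : l != 0 -> ~ (forall k : nat, root P (l * q ^+ k)).
  move=> l0 H; have := @max_poly_roots _ P [seq l * q ^+ (val k) | k <- enum 'I_(size P)] nzP.
  rewrite size_map size_enum_ord ltnn => F; suff: false by [].
  apply: F; first by apply/allP => x /mapP[k _ ->].
  rewrite map_inj_uniq ?enum_uniq // => k1 k2 /(mulfI l0)/expq_inj; exact: val_inj.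
have nroots' (l : K) : l != 0 -> ~ (forall k : nat, root P (l / q ^+ k)).
  move=> l0 H; have := @max_poly_roots _ P [seq l / q ^+ (val k) | k <- enum 'I_(size P)] nzP.
  rewrite size_map size_enum_ord ltnn => F; suff: false by [].
  apply: F; first by apply/allP => x /mapP[k _ ->].
  rewrite map_inj_uniq ?enum_uniq // => k1 k2 /(mulfI l0)/invr_inj/expq_inj; exact: val_inj.
have noA i (k : int) : k != 0 -> forall j, A i * q ^ k != A j.
  move=> k0 j; have [<-|ij] := eqVneq i j; last by rewrite eq_sym Aclass // eq_sym.
  rewrite -[X in _ != X]mulr1 (inj_eq (mulfI (A0 i))).
  case: k k0 => n n0; first by rewrite -exprnP qroot // lt0n.
  by rewrite NegzE -exprnN invr_eq1 qroot.
(* A root [A i] would propagate to all [A i / q ^+ k], since these meet no [A j] for [k > 0];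
   likewise upwards from [q * A i]. *)
have rA i : ~~ root P (A i).
  apply/negP => r; apply: (nroots' (A i) (A0 i)) => k.
  elim: k => [|k IH]; first by rewrite expr0 divr1.
  rewrite rootE => [|j]; last by have := noA i (- k.+1%:Z) isT j; rewrite exprnN.
  by rewrite exprS invfM mulrCA mulVKf // mulrC.
have rqA i : ~~ root P (q * A i).
  apply/negP => r; apply: (nroots (A i * q)); first by rewrite mulf_neq0.
  elim => [|k IH]; first by rewrite expr0 mulr1 mulrC.
  suff -> : A i * q * q ^+ k.+1 = q * (A i * q * q ^+ k).
    by rewrite -rootE // => j; rewrite -mulrA -exprS; exact: (noA i k.+1).
  by rewrite exprS; ring.
have injA : injective A.
  move=> i j E; apply/eqP; apply: contraT => /Aclass/(_ 0).
  by rewrite expr0z mulr1 E eqxx.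
(* [T] kills both [f] and [w], hence their difference, the exponential sum. *)
pose T := P * (P \Po (q *: 'X)).
have TA i : T.[A i] != 0.
  by rewrite hornerM horner_comp !hornerE mulf_neq0 //; [exact: rA|exact: rqA].
have [N1 HT] : ekill T (fun N => \sum_i b i * A i ^+ N).
  apply: (@eq_ekill _ _ (fun N => f N + - w N) _ 0%N) => [N _|].
    by rewrite /f addrC addKr.
  apply: ekill_addf; first exact: ekillMl.
  by apply: ekill_oppf; rewrite /T mulrC; apply: ekillMl.
move=> i; have : b i * T.[A i] = 0.
  apply: (@geom_indep K m A (fun i => b i * T.[A i]) N1) => // N le.
  rewrite -[RHS](HT N le) act_sumf; apply: eq_bigr => j _; rewrite act_geom //.
by move/eqP; rewrite mulf_eq0 (negPf (TA i)) orbF => /eqP.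
Qed.

End QRec.

(** * Divisibility of Hankel determinants *)

Section AbsVal.
Variables (K : fieldType) (R : realType) (v : K -> R).
Hypothesis av : absolute_value v.

Lemma av_ge0 x : 0 <= v x. Proof. by case: av. Qed.
Lemma av_eq0 x : (v x == 0) = (x == 0). Proof. by case: av. Qed.
Lemma avM x y : v (x * y) = v x * v y. Proof. by case: av. Qed.
Lemma av_leD x y : v (x + y) <= v x + v y. Proof. by case: av. Qed.

Lemma av_gt0 x : (0 < v x) = (x != 0).
Proof. by rewrite lt0r av_eq0 av_ge0 andbT. Qed.

Lemma av0 : v 0 = 0. Proof. by apply/eqP; rewrite av_eq0. Qed.

Lemma av1 : v 1 = 1.
Proof.
have nz : v 1 != 0 by rewrite av_eq0 oner_eq0.
by apply: (mulfI nz); rewrite -avM !mulr1.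
Qed.

Lemma avX x n : v (x ^+ n) = v x ^+ n.
Proof. by elim: n => [|n IH]; rewrite ?expr0 ?av1 // !exprS avM IH. Qed.

Lemma avV x : v x^-1 = (v x)^-1.
Proof.
have [->|nz] := eqVneq x 0; first by rewrite invr0 av0 invr0.
have nzv : v x != 0 by rewrite av_eq0.
by apply: (mulfI nzv); rewrite -avM !mulfV // av1.
Qed.

Lemma avN x : v (- x) = v x.
Proof.
rewrite -mulN1r avM; suff -> : v (-1) = 1 by rewrite mul1r.
apply/eqP; rewrite -(@pexpr_eq1 _ _ 2) ?av_ge0 //.
by rewrite -avX sqrrN expr1n av1.
Qed.

Lemma av_prod (I : Type) (r : seq I) (P : pred I) (F : I -> K) :
  v (\prod_(i <- r | P i) F i) = \prod_(i <- r | P i) v (F i).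
Proof. by apply: (big_morph v avM av1). Qed.

Lemma av_le_sum (I : Type) (r : seq I) (P : pred I) (F : I -> K) :
  v (\sum_(i <- r | P i) F i) <= \sum_(i <- r | P i) v (F i).
Proof.
elim/big_rec2: _ => [|i x y _ H]; first by rewrite av0.
by apply: (le_trans (av_leD _ _)); rewrite lerD2l.
Qed.

Hypothesis ultra : forall x y, v (x + y) <= Num.max (v x) (v y).

Lemma av_ultra x y B : v x <= B -> v y <= B -> v (x + y) <= B.
Proof. by move=> hx hy; apply: (le_trans (ultra _ _)); rewrite ge_max hx hy. Qed.

Lemma av_ultraB x y B : v x <= B -> v y <= B -> v (x - y) <= B.
Proof. by move=> hx hy; apply: av_ultra; rewrite ?avN. Qed.

Lemma av_ultra_sum (I : Type) (r : seq I) (P : pred I) (F : I -> K) B :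
  0 <= B -> (forall i, P i -> v (F i) <= B) -> v (\sum_(i <- r | P i) F i) <= B.
Proof.
move=> B0 H; elim/big_rec: _ => [|i x Pi]; first by rewrite av0.
by apply: av_ultra; apply: H.
Qed.

Lemma av_nat_le1 n : v n%:R <= 1.
Proof. by elim: n => [|n IH]; rewrite ?av0 ?ler01 // -addn1 natrD; apply: av_ultra; rewrite ?av1. Qed.

Lemma avM_le1 x y : v x <= 1 -> v y <= 1 -> v (x * y) <= 1.
Proof. by move=> hx hy; rewrite avM mulr_ile1 ?av_ge0. Qed.

Lemma avX_le1 x n : v x <= 1 -> v (x ^+ n) <= 1.
Proof. by move=> hx; rewrite avX exprn_ile1 ?av_ge0. Qed.

Lemma av_det_le M (B : 'M[K]_M) (c : 'I_M -> R) :
  (forall i j, v (B i j) <= c i) -> v (\det B) <= \prod_i c i.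
Proof.
move=> H; apply: av_ultra_sum => [|s _].
  by apply: prodr_ge0 => i _; apply: le_trans (H i i); apply: av_ge0.
rewrite avM avX avN av1 expr1n mul1r av_prod.
by apply: ler_prod => i _; rewrite av_ge0 H.
Qed.

End AbsVal.

Section MonicDeg.
Variable K : fieldType.

Lemma act_Xn r (h : nat -> K) N : act 'X^r h N = h (N + r)%N.
Proof.
elim: r N => [|k IH] N; first by rewrite expr0 -polyC1 actC mul1r addn0.
by rewrite exprSr actMX IH addSnnS.
Qed.

Lemma act_XnsubC n (c : K) h N : act ('X^n - c%:P) h N = h (N + n)%N - c * h N.
Proof. by rewrite actD -polyCN actC mulNr act_Xn. Qed.

Definition monic_deg (p : {poly K}) d := p \is monic /\ size p = d.+1.

Lemma monic_degM p1 p2 d e : monic_deg p1 d -> monic_deg p2 e -> monic_deg (p1 * p2) (d + e).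
Proof.
move=> [m1 z1] [m2 z2]; split; first by rewrite monicMl.
by rewrite size_monicM ?monic_neq0 // z1 z2; lia.
Qed.

Lemma monic_degX p d k : monic_deg p d -> monic_deg (p ^+ k) (d * k).
Proof.
move=> H; elim: k => [|k IH]; last by rewrite exprS mulnS; apply: monic_degM.
by rewrite expr0 muln0; split; rewrite ?monic1 ?size_poly1.
Qed.

Lemma monic_deg_prod (I : Type) (r : seq I) (p : I -> {poly K}) d :
  (forall i, monic_deg (p i) d) -> monic_deg (\prod_(i <- r) p i) (d * size r).
Proof.
move=> H; elim: r => [|i r IH]; last by rewrite big_cons /= mulnS; apply: monic_degM.
by rewrite big_nil muln0; split; rewrite ?monic1 ?size_poly1.
Qed.

End MonicDeg.

(** * Smallness of the Hankel determinant modulo a factor of [q ^+ n - 1] *)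

Section Filtration.
Variables (K : fieldType) (R : realType) (v : K -> R).
Hypotheses (av : absolute_value v) (ultra : forall x y, v (x + y) <= Num.max (v x) (v y)).
Variables (q D a a' : K) (n m : nat) (A b : 'I_m -> K) (w : nat -> K) (N0 : nat).
Hypotheses (n0 : (0 < n)%N) (qaa : q ^+ n - 1 = a * a').
Hypotheses (vq : v q <= 1) (vD : v D <= 1) (va : v a <= 1) (va' : v a' <= 1).
Hypotheses (vA : forall i, v (A i) <= 1) (vb : forall i, v (b i) <= 1).
Hypothesis wrec : forall N, (N0 <= N)%N ->
  w N.+1 = D * q ^+ N * (w N + \sum_i b i * A i ^+ N).
Hypothesis vw : forall N, (N0 <= N)%N -> v (w N) <= 1.

(** The size of one unit of weight; as [a] has weight 2, determinants are bounded through their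
    squares. *)
Let s : R := Num.sqrt (v a).

Let s2 : s ^+ 2 = v a.
Proof. by rewrite sqr_sqrtr // av_ge0. Qed.

Let s0 : 0 <= s. Proof. exact: sqrtr_ge0. Qed.

Let s1 : s <= 1.
Proof. by rewrite -(expr_le1 (n := 2)) // s2. Qed.

Let sX k l : (k <= l)%N -> s ^+ l <= s ^+ k.
Proof. by move=> le; apply: ler_wiXn2l. Qed.

(** The quotient of [q ^+ (n * N) - 1] by [a], as a geometric sum that is visibly integral. *)
Let y (N : nat) : K := a' * \sum_(j < N) q ^+ (n * j).

Let yE N : q ^+ (n * N) = 1 + a * y N.
Proof.
rewrite /y mulrA -qaa; apply/eqP; rewrite addrC -subr_eq; apply/eqP.
rewrite exprM subrX1; congr (_ * _); apply: eq_bigr => j _; by rewrite exprM.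
Qed.

Let vy N : v (y N) <= 1.
Proof. by apply: avM_le1 => //; apply: av_ultra_sum => // j _; apply: avX_le1. Qed.

(* [a] has weight 2 and [y] weight -1, so that [q ^+ (n * N) - 1 = a * y N] has weight 1
   and the shift by [n] is the identity up to weight 1, on [y] as well. *)
Inductive fil : nat -> (nat -> K) -> Prop :=
| fil_base k c j : v c <= s ^+ k -> fil k (fun N => c * q ^+ (j * N))
| fil_y k g : fil k.+1 g -> fil k (fun N => y N * g N)
| fil_add k g h : fil k g -> fil k h -> fil k (fun N => g N + h N).

Lemma eq_fil k g h : g =1 h -> fil k g -> fil k h.
Proof. by move/funext => ->. Qed.

Lemma fil_le k l g : (k <= l)%N -> fil l g -> fil k g.
Proof.
move=> le F; elim: F k le => {l g} [l c j vc|l g F IH|l g h F IHg G IHh] k le.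
- by apply: fil_base; apply: le_trans vc (sX le).
- by apply: fil_y; apply: IH.
- by apply: fil_add; [apply: IHg|apply: IHh].
Qed.

Lemma fil_bound k g N : fil k g -> v (g N) <= s ^+ k.
Proof.
elim=> {k g} [k c j vc|k g F IH|k g h F IHg G IHh].
- rewrite avM // -[X in _ <= X]mulr1; apply: ler_pM; rewrite ?av_ge0 //.
  exact: avX_le1.
- rewrite avM // -[X in _ <= X]mul1r; apply: ler_pM; rewrite ?av_ge0 //.
  by apply: le_trans IH (sX _).
- exact: av_ultra.
Qed.

Lemma fil_mulb k u c j g : v c <= s ^+ u -> fil k g ->
  fil (u + k) (fun N => c * q ^+ (j * N) * g N).
Proof.
move=> vc; elim=> {k g} [k c' j' vc'|k g F IH|k g h F IHg G IHh].
- apply: (@eq_fil _ (fun N => (c * c') * q ^+ ((j + j') * N))).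
    by move=> N; rewrite mulnDl exprD; ring.
  by apply: fil_base; rewrite avM // exprD; apply: ler_pM; rewrite ?av_ge0.
- apply: (@eq_fil _ (fun N => y N * (c * q ^+ (j * N) * g N))) => [N|]; first by ring.
  by apply: fil_y; rewrite -addnS.
- by apply: eq_fil (fil_add IHg IHh) => N; rewrite mulrDr.
Qed.

Lemma fil_cM k u c g : v c <= s ^+ u -> fil k g -> fil (u + k) (fun N => c * g N).
Proof. by move=> vc F; apply: eq_fil (fil_mulb 0 vc F) => N; rewrite mul0n mulr1. Qed.

Lemma fil_cM0 k c g : v c <= 1 -> fil k g -> fil k (fun N => c * g N).
Proof. by move=> vc F; rewrite -[k]add0n; apply: fil_cM. Qed.

Lemma fil_mul k u g h : fil k g -> fil u h -> fil (k + u) (fun N => g N * h N).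
Proof.
move=> F G; elim: F => {k g} [k c j vc|k g F IH|k g g' F IHg F' IHh].
- exact: fil_mulb.
- by apply: eq_fil (fil_y IH) => N; rewrite mulrA.
- by apply: eq_fil (fil_add IHg IHh) => N; rewrite mulrDl.
Qed.

Lemma fil_mull k g h : fil k g -> fil 0 h -> fil k (fun N => g N * h N).
Proof. by move=> F G; rewrite -[k]addn0; apply: fil_mul. Qed.

Lemma fil_sub k g h : fil k g -> fil k h -> fil k (fun N => g N - h N).
Proof.
move=> F G; apply: fil_add => //.
by apply: (@eq_fil _ (fun N => (-1) * h N)) => [N|]; rewrite ?mulN1r //; apply: fil_cM0; rewrite ?avN // av1.
Qed.

Lemma fil_diff k g : fil k g -> fil k.+1 (fun N => g (N + n)%N - g N).
Proof.
elim=> {k g} [k c j vc|k g F IH|k g h F IHg G IHh].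
- apply: (@eq_fil _ (fun N => (c * (a * y j)) * q ^+ (j * N))).
    move=> N; have := yE j; rewrite mulnC mulnDr exprD => ->; ring.
  apply: fil_base; apply: (@le_trans _ _ (s ^+ k.+2)); last exact: sX.
  rewrite -(addn2 k) exprD avM //; apply: ler_pM; rewrite ?av_ge0 //.
  by rewrite avM // s2 ler_piMr ?av_ge0.
(* Discrete Leibniz rule: the difference of [y] is [y n * q ^+ (n * N)], of weight 0 instead of -1,
   and the difference of [g] gains one unit by induction. *)
- have Fs : fil k.+1 (fun N => g (N + n)%N).
    by apply: eq_fil (fil_add F (fil_le (leqnSn _) IH)) => N; rewrite addrC subrK.
  apply: (@eq_fil _ (fun N => y N * (g (N + n)%N - g N) + y n * q ^+ (n * N) * g (N + n)%N)).
    move=> N; suff -> : y (N + n)%N = y N + y n * q ^+ (n * N) by ring.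
    rewrite /y big_split_ord /= mulrDr; congr (_ + _); rewrite -mulrA mulr_suml; congr (_ * _).
    by apply: eq_bigr => j _; rewrite -exprD mulnDr addnC.
  apply: fil_add; first exact: fil_y.
  by rewrite -[k.+1]add0n; apply: fil_mulb.
- by apply: eq_fil (fil_add IHg IHh) => N; ring.
Qed.

Lemma fil_shift k g : fil k g -> fil k (fun N => g (N + n)%N).
Proof.
move=> F; have G := fil_le (leqnSn _) (fil_diff F).
by apply: eq_fil (fil_add F G) => N; rewrite addrC subrK.
Qed.

Lemma fil_unip k g : fil k g -> fil k.+1 (fun N => (q ^+ (n * N) - 1) * g N).
Proof.
move=> F; apply: (@eq_fil _ (fun N => y N * (a * g N))) => [N|].
  by rewrite yE; ring.
by apply: fil_y; rewrite -[k.+2]/(2 + k)%N; apply: fil_cM; rewrite // s2.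
Qed.

Lemma fil_cst c : v c <= 1 -> fil 0 (fun=> c).
Proof.
move=> vc; apply: (@eq_fil _ (fun N => c * q ^+ (0 * N))) => [N|]; last exact: fil_base.
by rewrite mul0n mulr1.
Qed.

Lemma fil_q : fil 0 (fun N => q ^+ N).
Proof.
apply: (@eq_fil _ (fun N => 1 * q ^+ (1 * N))) => [N|]; first by rewrite mul1n mul1r.
by apply: fil_base; rewrite av1.
Qed.

(** For [l = n] the coefficient of [w N] is [q ^+ (n * N)] times a constant, hence constant up to
    weight 1: this is the periodicity that ['X^n - eps%:P] exploits. *)
Lemma wrec_iter l : exists2 G : 'I_m -> nat -> K, (forall i, fil 0 (G i)) &
  forall N, (N0 <= N)%N -> w (N + l)%N =
    D ^+ l * q ^+ 'C(l, 2) * q ^+ (l * N) * w N + \sum_i A i ^+ N * G i N.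
Proof.
elim: l => [|l [G FG E]].
  exists (fun _ _ => 0) => [i|N le]; first by apply: fil_cst; rewrite av0.
  by rewrite big1 => [|i _]; rewrite ?mulr0 // addn0 mul0n !expr0 !mul1r addr0.
exists (fun i N => (D * q ^+ l) * (q ^+ N * (G i N + b i * A i ^+ l))) => [i|N le].
  apply: fil_cM0; first by apply: avM_le1 => //; apply: avX_le1.
  apply: (fil_mull fil_q); apply: fil_add => //; apply: fil_cst.
  by apply: avM_le1 => //; apply: avX_le1.
rewrite addnS wrec ?(leq_trans le) ?leq_addr // E // mulSn binS bin1 !exprD exprS.
rewrite -addrA -big_split /= mulrDr mulr_sumr; congr (_ + _); first by ring.
by apply: eq_bigr => i _; rewrite exprD; ring.
Qed.

Let eps := D ^+ n * q ^+ 'C(n, 2).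

Let veps : v eps <= 1.
Proof. by apply: avM_le1 => //; apply: avX_le1. Qed.

(** The span of [w] and the geometric sequences over filtered coefficients, on which the operators
    below raise weights one component at a time. *)
Definition comb (p0 : nat) (p : 'I_m -> nat) (h : nat -> K) :=
  exists g0, exists2 g : 'I_m -> nat -> K, fil p0 g0 /\ (forall i, fil (p i) (g i)) &
  forall N, (N0 <= N)%N -> h N = g0 N * w N + \sum_i g i N * A i ^+ N.

Lemma comb_act p0 p h (c : K) : comb p0 p h -> exists g0, exists g, exists G, [/\ fil p0 g0,
  forall i, fil (p i) (g i), forall i, fil 0 (G i) & forall N, (N0 <= N)%N ->
  act ('X^n - c%:P) h N = (eps * q ^+ (n * N) * g0 (N + n)%N - c * g0 N) * w N +
    \sum_i (g0 (N + n)%N * G i N + (A i ^+ n * g i (N + n)%N - c * g i N)) * A i ^+ N].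
Proof.
move=> [g0 [g [F0 F] E]]; have [G FG EG] := wrec_iter n.
exists g0, g, G; split=> // N le.
rewrite act_XnsubC !E // ?(leq_trans le) ?leq_addr // EG // -/eps.
rewrite [X in _ = _ + X](_ : _ = g0 (N + n)%N * (\sum_i A i ^+ N * G i N) +
   \sum_i g i (N + n)%N * A i ^+ (N + n) - c * \sum_i g i N * A i ^+ N); last first.
  rewrite !mulr_sumr -big_split -sumrB /=; apply: eq_bigr => i _; rewrite exprD; ring.
ring.
Qed.

Lemma comb_eps k h : comb k (fun=> 0%N) h -> comb k.+1 (fun=> 0%N) (act ('X^n - eps%:P) h).
Proof.
move=> /(comb_act eps)[g0 [g [G [F0 F FG E]]]].
exists (fun N => eps * ((q ^+ (n * N) - 1) * g0 (N + n)%N + (g0 (N + n)%N - g0 N))).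
exists (fun i N => g0 (N + n)%N * G i N + (A i ^+ n * g i (N + n)%N - eps * g i N)).
  split=> [|i].
    apply: fil_cM0 => //; apply: fil_add; last exact: fil_diff.
    by apply: fil_unip; apply: fil_shift.
  apply: fil_add; first by apply: fil_mull => //; apply: fil_le (fil_shift F0).
  apply: fil_sub; apply: fil_cM0 => //; first exact: avX_le1.
  exact: fil_shift.
by move=> N le; rewrite E //; congr (_ * _ + _); ring.
Qed.

(** The coefficient of [w] leaks into every geometric component with weight [F], so components can
    be raised only up to [F]. Hence the weight of [w] is raised first, by [F] applications of
    ['X^n - eps%:P]. *)
Lemma comb_A F (p : 'I_m -> nat) i0 h : (forall i, (p i <= F)%N) -> (p i0 < F)%N ->
  comb F p h -> comb F (fun i => if i == i0 then (p i).+1 else p i) (act ('X^n - (A i0 ^+ n)%:P) h).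
Proof.
move=> pF pi0 /(comb_act (A i0 ^+ n))[g0 [g [G [F0 Fg FG E]]]].
exists (fun N => eps * ((q ^+ (n * N) - 1) * g0 (N + n)%N + g0 (N + n)%N) - A i0 ^+ n * g0 N).
exists (fun i N => g0 (N + n)%N * G i N + (A i ^+ n * g i (N + n)%N - A i0 ^+ n * g i N)); last first.
  by move=> N le; rewrite E //; congr (_ * _ + _); ring.
split=> [|i].
  apply: fil_sub; apply: fil_cM0 => //; last exact: avX_le1.
  apply: fil_add; last exact: fil_shift.
  by apply: fil_le (leqnSn _) (fil_unip (fil_shift _)).
apply: fil_add.
  by apply: fil_mull => //; apply: fil_le (fil_shift F0); case: eqP => // ->.
case: eqP => [->|_].
  apply: (@eq_fil _ (fun N => A i0 ^+ n * (g i0 (N + n)%N - g i0 N))) => [N|]; first by ring.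
  by apply: fil_cM0; [exact: avX_le1|exact: fil_diff].
by apply: fil_sub; apply: fil_cM0; rewrite ?avX_le1 //; apply: fil_shift.
Qed.

Lemma eq_comb p0 p p' h h' : p =1 p' -> h =1 h' -> comb p0 p h -> comb p0 p' h'.
Proof. by move=> /funext -> /funext ->. Qed.

Lemma comb_A_exp F p i0 t h : (forall i, (p i <= F)%N) -> (p i0 + t <= F)%N ->
  comb F p h ->
  comb F (fun i => if i == i0 then (p i + t)%N else p i) (act (('X^n - (A i0 ^+ n)%:P) ^+ t) h).
Proof.
move=> pF; elim: t => [|t IH] pi0 C.
  apply: eq_comb C => [i|N]; first by case: eqP; rewrite ?addn0.
  by rewrite expr0 -polyC1 actC mul1r.
have {IH} := IH ltac:(lia) C.
move/(@comb_A F _ i0); rewrite eqxx => C'.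
apply: eq_comb (C' _ _) => [i|N|i|].
- by case: eqP => // _; rewrite addnS.
- by rewrite exprS act_mul.
- by case: eqP => [->|//]; lia.
- by rewrite -addnS.
Qed.

Lemma comb_A_prod F h (r : seq 'I_m) : uniq r -> comb F (fun=> 0%N) h ->
  comb F (fun i => if i \in r then F else 0%N)
    (act (\prod_(i <- r) ('X^n - (A i ^+ n)%:P) ^+ F) h).
Proof.
move=> + C; elim: r => [_|i0 r IH /= /andP[ir ur]].
  by apply: eq_comb C => // N; rewrite big_nil -polyC1 actC mul1r.
have C' := @comb_A_exp F _ i0 F _ _ _ (IH ur).
apply: eq_comb (C' _ _) => [i|N|i|].
- by rewrite inE; case: eqP => // ->; rewrite (negPf ir).
- by rewrite big_cons act_mul.
- by case: ifP.
- by rewrite (negPf ir).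
Qed.

Definition psi F : {poly K} :=
  (\prod_i ('X^n - (A i ^+ n)%:P) ^+ F) * ('X^n - eps%:P) ^+ F.

Lemma act_psi_le F N : (N0 <= N)%N -> v (act (psi F) w N) <= s ^+ F.
Proof.
move=> le.
have C0 : comb F (fun=> 0%N) (act (('X^n - eps%:P) ^+ F) w).
  elim: F => [|F IH].
    exists (fun=> 1); exists (fun _ _ => 0).
      by split=> [|i]; apply: fil_cst; rewrite ?av1 ?av0.
    move=> k _; rewrite expr0 -polyC1 actC mul1r big1 ?addr0 ?mul1r // => i _.
    by rewrite mul0r.
  by apply: eq_comb (comb_eps IH) => // k; rewrite exprS act_mul.
have [g0 [g [F0 Fg] E]] := comb_A_prod (index_enum_uniq _) C0.
rewrite /psi act_mul E //; apply: av_ultra => //.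
  rewrite avM // -[X in _ <= X]mulr1; apply: ler_pM; rewrite ?av_ge0 ?vw //.
  exact: fil_bound.
apply: av_ultra_sum => //; first exact: exprn_ge0.
move=> i _.
rewrite avM // -[X in _ <= X]mulr1; apply: ler_pM; rewrite ?av_ge0 ?avX_le1 //.
by have := fil_bound N (Fg i); rewrite mem_index_enum.
Qed.

Lemma monic_deg_psi F : monic_deg (psi F) (n * m.+1 * F).
Proof.
have X c : monic_deg ('X^n - c%:P) n by split; [apply: monicXnsubC|rewrite size_XnsubC].
have -> : (n * m.+1 * F = n * F * m + n * F)%N by lia.
apply: monic_degM; last exact: monic_degX.
rewrite -[X in (n * F * X)%N](size_enum_ord m) -big_enum /=.
by apply: monic_deg_prod => i; apply: monic_degX.
Qed.

(** A unitriangular row operation puts into row [i] the action on [w] of any monic polynomial of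
    degree [i]. One unit of weight costs one factor of each kind in [psi], of total degree
    [n * m.+1], so row [i] reaches weight [i %/ (n * m.+1)]. *)
Lemma hankel_det_le M :
  v (\det (\matrix_(i < M, j < M) w (N0 + (i + j))%N)) ^+ 2
    <= v a ^+ (\sum_(i < M) i %/ (n * m.+1)).
Proof.
set H := \matrix_(i < M, j < M) _; set e := (n * m.+1)%N.
pose Psi (i : nat) := 'X^(i %% e) * psi (i %/ e).
have degPsi i : monic_deg (Psi i) i.
  rewrite [X in monic_deg _ X](divn_eq i e) addnC mulnC; apply: monic_degM (monic_deg_psi _).
  by split; rewrite ?monicXn ?size_polyXn.
pose T := \matrix_(i < M, l < M) (Psi i)`_l.
have detT : \det T = 1.
  rewrite det_trig; last first.
    apply/is_trig_mxP => i j ij; rewrite mxE nth_default //.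
    by have [_ ->] := degPsi i.
  rewrite big1 // => i _; rewrite mxE; have [/monicP + z] := degPsi i.
  by rewrite lead_coefE z.
have -> : \det H = \det (T *m H) by rewrite det_mulmx detT mul1r.
have B : v (\det (T *m H)) <= \prod_(i < M) s ^+ (i %/ e).
  apply: av_det_le => // i j.
  suff -> : (T *m H) i j = act (psi (i %/ e)) w (N0 + j + i %% e)%N.
    by apply: act_psi_le; rewrite -addnA leq_addr.
  rewrite -act_Xn -act_mul (@act_widen _ _ _ _ M); last first.
    by have [_ ->] := degPsi i.
  rewrite mxE; apply: eq_bigr => l _; rewrite !mxE; congr (_ * w _); lia.
rewrite -s2 exprAC expr_sum.
by rewrite ler_pXn2r ?nnegrE ?av_ge0 ?prodr_ge0 // => i _; apply: exprn_ge0.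
Qed.

End Filtration.

(** * Discrete valuations of a number field *)

Section Subrings.
Variable K : fieldType.

Definition is_subring (A : set K) :=
  [/\ A 1, forall x y, A x -> A y -> A (x - y) & forall x y, A x -> A y -> A (x * y)].

Section Closure.
Variable A : set K.
Hypothesis sA : is_subring A.

Lemma subr_1 : A 1. Proof. by case: sA. Qed.
Lemma subr_B x y : A x -> A y -> A (x - y). Proof. by case: sA => _ + _; apply. Qed.
Lemma subr_M x y : A x -> A y -> A (x * y). Proof. by case: sA => _ _; apply. Qed.
Lemma subr_0 : A 0. Proof. by rewrite -(subrr 1); apply: subr_B; apply: subr_1. Qed.
Lemma subr_N x : A x -> A (- x). Proof. by rewrite -sub0r; apply: subr_B; apply: subr_0. Qed.
Lemma subr_D x y : A x -> A y -> A (x + y).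
Proof. by move=> Ax Ay; rewrite -[y]opprK; apply: subr_B => //; apply: subr_N. Qed.
Lemma subr_X x n : A x -> A (x ^+ n).
Proof. by move=> Ax; elim: n => [|n IH]; [exact: subr_1|rewrite exprS; apply: subr_M]. Qed.
Lemma subr_sum (I : Type) (r : seq I) (P : pred I) (F : I -> K) :
  (forall i, P i -> A (F i)) -> A (\sum_(i <- r | P i) F i).
Proof. by move=> H; apply: big_ind => //; [exact: subr_0|exact: subr_D]. Qed.
Lemma subr_nat n : A n%:R.
Proof. by elim: n => [|n IH]; [exact: subr_0|rewrite -addn1 natrD; apply: subr_D => //; exact: subr_1]. Qed.
Lemma subr_int (n : int) : A n%:~R.
Proof. by case: n => n; [exact: subr_nat|rewrite NegzE mulrNz; apply: subr_N; exact: subr_nat]. Qed.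

Definition adjoin (y : K) : set K := [set h | exists2 p : {poly K}, (forall i, A p`_i) & h = p.[y]].

Lemma adjoin_subring y : is_subring (adjoin y).
Proof.
split=> [|_ _ [p Ap ->] [r Ar ->]|_ _ [p Ap ->] [r Ar ->]].
- exists 1; last by rewrite hornerC.
  by move=> i; rewrite coef1; case: eqP => _; [exact: subr_1|exact: subr_0].
- exists (p - r); last by rewrite hornerD hornerN.
  by move=> i; rewrite coefB; apply: subr_B.
- exists (p * r); last by rewrite hornerM.
  by move=> i; rewrite coefM; apply: subr_sum => j _; apply: subr_M.
Qed.

Lemma sub_adjoin y z : A z -> adjoin y z.
Proof.
move=> Az; exists z%:P; last by rewrite hornerC.
by move=> i; rewrite coefC; case: eqP => _ //; exact: subr_0.
Qed.

Lemma mem_adjoin y : adjoin y y.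
Proof.
exists 'X; last by rewrite hornerX.
by move=> i; rewrite coefX; case: eqP => _; [exact: subr_1|exact: subr_0].
Qed.

End Closure.

Lemma range_int_subring : is_subring (range (fun n : int => n%:~R : K)).
Proof.
split; first by exists 1.
- by move=> _ _ [n _ <-] [k _ <-]; exists (n - k) => //; rewrite rmorphB.
- by move=> _ _ [n _ <-] [k _ <-]; exists (n * k) => //; rewrite rmorphM.
Qed.

(* A relation [x = p(1/x)] over a subring becomes a monic equation for [x] after multiplication
   by a power of [x]. *)
Lemma integral_of_adjoin_inv (x : K) : x != 0 ->
  adjoin (range (fun n : int => n%:~R : K)) x^-1 x -> integralOver (intr : int -> K) x.
Proof.
move=> x0 [p Ap E].
have /choice[c cE] : forall i, exists n : int, n%:~R = p`_i.
  by move=> i; have [n _ <-] := Ap i; exists n.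
pose n := size p.
pose r : {poly int} := 'X^(n.+1) - \poly_(i < n.+1) c (n - i)%N.
exists r.
  rewrite monicE /r lead_coefDl ?lead_coefXn // size_polyN size_polyXn ltnS.
  exact: size_poly.
rewrite /r rmorphB /= map_polyXn.
rewrite rootE hornerD hornerN hornerXn (@horner_coef_wide _ n.+1); last first.
  by apply: (leq_trans (size_poly _ _)); exact: size_poly.
rewrite subr_eq0; apply/eqP.
rewrite exprS {1}E (@horner_coef_wide _ n.+1 _ x^-1) ?leqnSn // mulr_suml.
rewrite (reindex_inj rev_ord_inj) /=; apply: eq_bigr => i _.
rewrite coef_map /= coef_poly ltn_ord subSS cE; rewrite -mulrA; congr (_ * _).
rewrite exprVn mulrC; apply/eqP.
by rewrite -(inj_eq (mulIf (expf_neq0 (n - i) x0))) divfK ?expf_neq0 // -exprD subnKC // -ltnS.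
Qed.

Section MaximalSubring.
Variable x : K.
Hypotheses (x0 : x != 0).

(** Chevalley's construction, started from Z[1/x], which misses [x] because [x] is not integral. *)
Lemma exists_maximal_subring : ~ integralOver (intr : int -> K) x ->
  exists2 A : set K, [/\ is_subring A, A x^-1 & ~ A x] &
   forall B, is_subring B -> A `<=` B -> ~ B x -> B `<=` A.
Proof.
move=> nint.
pose good (A : set K) := [/\ is_subring A, A x^-1 & ~ A x].
have [F FP tot|A [PA maxA]] := @Zorn_bigcup K (fun A => A = set0 \/ good A).
  have [[X0 FX0 gX0]|none] := pselect (exists2 X, F X & good X); last first.
    left; apply/seteqP; split=> // z [X FX Xz].
    by case: (FP _ FX) => [e|g]; [move: Xz; rewrite e|case: none; exists X].
  right; have pair y z : (\bigcup_(X in F) X) y -> (\bigcup_(X in F) X) z ->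
      exists X, [/\ F X, good X, X y & X z].
    move=> [X FX Xy] [Y FY Yz].
    have gX : good X by case: (FP _ FX) => // e; move: Xy; rewrite e.
    have gY : good Y by case: (FP _ FY) => // e; move: Yz; rewrite e.
    by case: (tot _ _ FX FY) => s; [exists Y|exists X]; split=> //; apply: s.
  split; last by move=> [X FX Xx]; case: (FP _ FX) => [e|[_ _ /(_ Xx)]//]; move: Xx; rewrite e.
    split.
    - by exists X0 => //; case: gX0 => [/subr_1].
    - by move=> y z /pair H /H [X [FX [sX _ _] Xy Xz]]; exists X => //; apply: subr_B.
    - by move=> y z /pair H /H [X [FX [sX _ _] Xy Xz]]; exists X => //; apply: subr_M.
  by exists X0 => //; case: gX0.
have gA : good A.
  case: PA => // A0; exfalso.
  pose B := adjoin (range (fun n : int => n%:~R : K)) x^-1.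
  have gB : good B.
    split; first exact: adjoin_subring range_int_subring _.
      exact: mem_adjoin range_int_subring _.
    by move/(integral_of_adjoin_inv x0).
  apply: (maxA B); last by right.
  rewrite A0; split=> // /(_ x^-1); apply; by case: gB.
exists A => // B sB AB nBx; apply: contrapT => nBA.
by apply: (maxA B) => //; right; split=> //; apply: AB; case: gA.
Qed.

Variable A : set K.
Hypotheses (sA : is_subring A) (At : A x^-1) (nAx : ~ A x).
Hypothesis maxA : forall B, is_subring B -> A `<=` B -> ~ B x -> B `<=` A.

Lemma maximal_adjoin y : ~ A y -> adjoin A y x.
Proof.
move=> nAy; apply: contrapT => n; apply: nAy.
apply: (maxA _ _ n); first exact: adjoin_subring.
  by move=> z; apply: sub_adjoin.
exact: mem_adjoin.
Qed.

(** [x^-1] lies in the Jacobson radical. If u = 1 - x^-1 a were not a unit, maximality would make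
    [x] a polynomial in u^-1, so x u^k would be in [A] for some k; but u^k is 1 modulo [x^-1], which
    would put [x] in [A]. *)
Lemma maximal_unit a : A a -> A (1 - x^-1 * a)^-1.
Proof.
move=> Aa; apply: contrapT => n; have [p Ap E] := maximal_adjoin n.
pose u := 1 - x^-1 * a; have u0 : u != 0.
  by apply/negP => /eqP u0; apply: n; rewrite -/u u0 invr0; apply: subr_0.
have Au : A u by apply: subr_B => //; [exact: subr_1|apply: subr_M].
have [a' Aa' ua'] : exists2 a', A a' & u ^+ size p = 1 - x^-1 * a'.
  elim: (size p) => [|k [a' Aa' IH]]; first by exists 0; [exact: subr_0|rewrite mulr0 subr0].
  exists (a + u * a'); first by apply: subr_D => //; apply: subr_M.
  by rewrite exprS IH /u; ring.
apply: nAx; have -> : x = x * u ^+ size p + a'.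
  by rewrite ua'; field.
apply: subr_D => //; rewrite {1}E horner_coef mulr_suml; apply: subr_sum => // i _.
rewrite -mulrA; apply: subr_M => //; rewrite -/u exprVn.
rewrite (_ : _ * _ = u ^+ (size p - i)); first exact: subr_X.
by apply: (mulfI (expf_neq0 i u0)); rewrite mulVKf ?expf_neq0 // -exprD subnKC // ltnW.
Qed.

(** If both are missing, then x = p(y) = r(y^-1), with deg r <= deg p by symmetry. Since x - r_0 is
    [x] times a unit, the relation [r] rewrites the leading term of [p] in lower powers of [y]:
    infinite descent on the sizes. *)
Lemma maximal_valuation y : A y \/ A y^-1.
Proof.
have [->|y0] := eqVneq y 0; first by left; apply: subr_0.
apply: contrapT => /not_orP[/maximal_adjoin[p Ap Ep] /maximal_adjoin[r Ar Er]].
have [k] := ubnP (size p + size r); elim: k y y0 p r Ap Ep Ar Er => // k IH y y0 p r.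
wlog le : y y0 p r / (size r <= size p)%N => [hw|] Ap Ep Ar Er lt.
  have [le|/ltnW le] := leqP (size r) (size p); first exact: (hw y y0 p r).
  apply: (hw y^-1 _ r p) => //; rewrite ?invr_eq0 ?invrK //; by rewrite addnC.
case En : (size p) le => [|n] le.
  by apply: nAx; rewrite Ep horner_coef En big_ord0; apply: subr_0.
pose u := (1 - x^-1 * r`_0)^-1.
have Au : A u by apply: maximal_unit.
have u1 : (x - r`_0) * x^-1 * u = 1.
  rewrite /u mulrBl mulfV // [r`_0 * _]mulrC mulfV //.
  rewrite subr_eq0; apply/negP => /eqP e; apply: nAx.
  by rewrite -[x]mulr1 e mulVKf.
pose p' := \poly_(i < n) (p`_i + p`_n * u * x^-1 * r`_(n - i)).
apply: (IH y y0 p' r) => //; last first.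
- by have := size_poly n (fun i => p`_i + p`_n * u * x^-1 * r`_(n - i)); rewrite -/p'; lia.
- rewrite Ep (horner_coef_wide _ (_ : size p' <= n)%N) ?size_poly // horner_coef En big_ord_recr /=.
  transitivity (\sum_(i < n) p`_i * y ^+ i + p`_n * u * x^-1 * (y ^+ n * (x - r`_0))).
    by congr (_ + _); rewrite -[LHS]mulr1 -u1; ring.
  have -> : y ^+ n * (x - r`_0) = \sum_(i < n) r`_(n - i) * y ^+ i.
    rewrite {1}Er (horner_coef_wide _ (_ : size r <= n.+1)%N) // big_ord_recl /= expr0 mulr1.
    rewrite addrC addKr mulr_sumr (reindex_inj rev_ord_inj) /=; apply: eq_bigr => i _.
    rewrite /bump /= add1n -subSn // subSS exprVn mulrCA; congr (_ * _).
    apply: (mulIf (expf_neq0 (n - i) y0)).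
    by rewrite divfK ?expf_neq0 // -exprD subnKC // ltnW.
  rewrite mulr_sumr -big_split /=; apply: eq_bigr => i _.
  by rewrite coef_poly ltn_ord; ring.
- move=> i; rewrite coef_poly; case: ifP => _; last exact: subr_0.
  by apply: subr_D => //; do !apply: subr_M => //.
Qed.

End MaximalSubring.
End Subrings.

(** The last two clauses are quantitative and uniform in [v]: a gap above 1, and a lower bound at
    integers with a common exponent [c]. They give thresholds valid at all places at once. *)
Definition disc_val (K : fieldType) (R : realType) (c : nat) (v : K -> R) :=
  [/\ absolute_value v, forall x y, v (x + y) <= Num.max (v x) (v y),
      forall x, 1 < v x -> 2 <= v x
    & forall n : nat, (0 < n)%N -> 1 <= v n%:R * n%:R ^+ c].

Lemma intr_extQ_inj (K : fieldExtType rat) : injective (intr : int -> K).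
Proof.
move=> i j; rewrite -!(rmorph_int (in_alg K)) => /fmorph_inj; exact: intr_inj.
Qed.

Lemma natr_extQ_neq0 (K : fieldExtType rat) n : (0 < n)%N -> n%:R != 0 :> K.
Proof.
move=> n0; apply/negP => /eqP; rewrite -[n%:R]/(n%:Z%:~R) => /(@intr_extQ_inj K n 0).
by case=> e; rewrite e in n0.
Qed.

Lemma int_poly_root (K : fieldExtType rat) (z : K) :
  exists p : {poly int}, [/\ p != 0, (size p <= (\dim {:K}).+1)%N & root (map_poly intr p) z].
Proof.
have /polyOver1P[r rE] := minPolyOver 1%AS z.
have [p [a a0 pE]] := rat_poly_scale r.
have inalg (k : int) : in_alg K k%:~R = k%:~R by rewrite rmorph_int.
have aK : in_alg K (a%:~R^-1) != 0.
  by rewrite fmorph_eq0 invr_eq0 intr_eq0.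
have E : minPoly 1%AS z = in_alg K (a%:~R^-1) *: map_poly intr p.
  rewrite rE pE linearZ /=.
  by rewrite -map_poly_comp; congr (_ *: _); apply: eq_map_poly => k /=; rewrite -inalg.
have nzM : minPoly 1%AS z != 0 by rewrite monic_neq0 // monic_minPoly.
exists p; split.
- by apply: contraNneq nzM => p0; rewrite E p0 rmorph0 scaler0.
- have -> : size p = size (minPoly 1%AS z).
    rewrite E size_scale // size_map_inj_poly ?rmorph0 //.
    exact: intr_extQ_inj.
  rewrite size_minPoly ltnS.
  have := dim_Fadjoin 1%AS z; rewrite dimv1 muln1 => <-.
  exact/dimvS/subvf.
- by have := root_minPoly 1%AS z; rewrite E rootZ.
Qed.

(** * Valuation rings of a number field and their residue characteristic *)

Section ValuationRing.
Variables (K : fieldExtType rat) (R : realType) (A : set K).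
Hypotheses (sA : is_subring A) (valA : forall y, A y \/ A y^-1).

(** Equality of values, before the value group is identified. *)
Definition assoc (y z : K) := A (y / z) /\ A (z / y).

Lemma subr_div_trans y z t : z != 0 -> A (y / z) -> A (z / t) -> A (y / t).
Proof.
by move=> z0 Ayz Azt; have -> : y / t = (y / z) * (z / t); [rewrite mulrA divfK|apply: subr_M].
Qed.

Lemma assocM y z y' z' : assoc y z -> assoc y' z' -> assoc (y * y') (z * z').
Proof.
by move=> [a b] [c e]; split; rewrite invfM mulrACA; apply: subr_M.
Qed.

Lemma assocX y z n : assoc y z -> assoc (y ^+ n) (z ^+ n).
Proof. by move=> [a b]; split; rewrite -exprVn -exprMn; apply: subr_X. Qed.

Lemma assoc_sym y z : assoc y z -> assoc z y. Proof. by case. Qed.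

Lemma assoc_trans y z t : z != 0 -> assoc y z -> assoc z t -> assoc y t.
Proof.
by move=> z0 [a b] [c e]; split; apply: (@subr_div_trans _ z).
Qed.

Lemma assoc_refl y : y != 0 -> assoc y y.
Proof. by move=> y0; split; rewrite mulfV //; apply: subr_1. Qed.

Lemma assocMl y z t : t != 0 -> assoc (t * y) (t * z) -> assoc y z.
Proof. by move=> t0 [a b]; split; [move: a|move: b]; rewrite invfM mulrACA mulfV // mul1r. Qed.

Lemma max_term (s : seq K) : (forall y, y \in s -> y != 0) -> s != [::] ->
  exists2 y, y \in s & forall z, z \in s -> A (z / y).
Proof.
elim: s => // y s IH nz _; have [->|sn] := eqVneq s [::].
  exists y; first by rewrite mem_head.
  by move=> z; rewrite inE => /eqP ->; rewrite mulfV ?nz ?mem_head //; apply: subr_1.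
have [|z zs max] := IH _ sn; first by move=> t ts; apply: nz; rewrite inE ts orbT.
have y0 : y != 0 by apply: nz; rewrite mem_head.
have z0 : z != 0 by apply: nz; rewrite inE zs orbT.
case: (valA (y / z)) => [yz|]; last rewrite invf_div => zy.
  by exists z => [|t]; rewrite inE ?zs ?orbT // => /predU1P[->|/max].
exists y => [|t]; rewrite inE ?eqxx // => /predU1P[->|/max tz].
  by rewrite mulfV //; apply: subr_1.
exact: (@subr_div_trans _ z).
Qed.

(** Nonunits of a valuation ring form an ideal; zero is set apart because [0^-1 = 0] lies in [A]. *)
Lemma nonunit_sum (I : eqType) (r : seq I) (F : I -> K) :
  (forall i, i \in r -> A (F i) /\ (F i != 0 -> ~ A (F i)^-1)) ->
  let S := \sum_(i <- r) F i in A S /\ (S != 0 -> ~ A S^-1).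
Proof.
elim: r => [_|i r IH H] /=.
  by rewrite big_nil eqxx; split=> //; apply: subr_0.
rewrite big_cons; have [|AS uS] := IH; first by move=> j jr; apply: H; rewrite inE jr orbT.
have [AF uF] := H i (mem_head _ _); set y := F i in AF uF *; set z := \sum_(j <- r) F j in AS uS *.
split; first exact: subr_D.
have [->|y0] := eqVneq y 0; first by rewrite add0r.
have [->|z0] := eqVneq z 0; first by rewrite addr0.
move=> yz0 Ayz; case: (valA (y / z)) => [q|]; last rewrite invf_div => q.
- apply: (uS z0); have -> : z^-1 = (1 + y / z) * (y + z)^-1 by field; rewrite z0 yz0.
  by apply: subr_M => //; apply: subr_D => //; apply: subr_1.
- apply: (uF y0); have -> : y^-1 = (1 + z / y) * (y + z)^-1 by field; rewrite y0 yz0.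
  by apply: subr_M => //; apply: subr_D => //; apply: subr_1.
Qed.

Variable x : K.
Hypotheses (x0 : x != 0) (At : A x^-1) (nAx : ~ A x).

(** The lowest nonzero coefficient of an integer polynomial with root [x^-1] is a multiple of [x^-1]
    in [A], hence not a unit. *)
Lemma nonunit_nat : exists n : nat, (0 < n)%N /\ ~ A n%:R^-1.
Proof.
have [p [p0 _ rp]] := int_poly_root x^-1.
have ex : exists i, p`_i != 0.
  by exists (size p).-1; rewrite -lead_coefE lead_coef_eq0.
case: (ex_minnP ex) => i pi0 min.
exists (absz p`_i); split; first by rewrite absz_gt0.
move=> An; apply: nAx.
have An' : A (p`_i)%:~R^-1.
  have [->|->] : (p`_i = (absz p`_i) \/ p`_i = - ((absz p`_i) : int)) by lia.
    exact: An.
  by rewrite rmorphN invrN; apply: subr_N.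
have ile : (i < size p)%N by rewrite ltnNge; apply: contraNN pi0 => /(nth_default 0) ->.
move/rootP: rp; rewrite horner_coef size_map_inj_poly ?rmorph0 //; last exact: intr_extQ_inj.
have E : \sum_(j < size p) (map_poly intr p)`_j * x^-1 ^+ j =
   x^-1 ^+ i * ((p`_i)%:~R + x^-1 * \sum_(j < size p - i.+1) (p`_(i.+1 + j))%:~R * x^-1 ^+ j).
  rewrite -(big_mkord xpredT (fun j => (map_poly intr p)`_j * x^-1 ^+ j)).
  rewrite (@big_cat_nat _ _ _ i) ?(ltnW ile) //= big_nat big1 => [|j /andP[_ ji]]; last first.
    rewrite coef_map /=; have -> : p`_j = 0; last by rewrite mul0r.
    by apply/eqP; apply: contraTT ji; rewrite -leqNgt; apply: min.
  rewrite add0r big_ltn // coef_map /= mulrDr mulrC; congr (_ + _).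
  rewrite mulrA -exprSr mulr_sumr -{1}[i.+1]add0n big_addn big_mkord; apply: eq_bigr => j _.
  by rewrite coef_map /= addnC exprD; ring.
rewrite E => /eqP; rewrite mulf_eq0 expf_eq0 invr_eq0 (negPf x0) andbF /= addr_eq0 => /eqP e.
set S := \sum_(j < _) _ in e; have AS : A S.
  apply: subr_sum => // j _; apply: subr_M => //; first exact: subr_int.
  exact: subr_X.
have -> : x = - (S * (p`_i)%:~R^-1).
  have pK : (p`_i)%:~R != 0 :> K.
    by rewrite -(rmorph0 (intr : int -> K)) (inj_eq (@intr_extQ_inj K)).
  by apply: (mulIf pK); rewrite mulNr divfK // e mulrN mulrA mulfV // mul1r.
by apply: subr_N => //; apply: subr_M.
Qed.

(** The least positive nonunit integer is prime, and Bezout's identity makes the integers prime to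
    it units. *)
Lemma nonunit_prime : exists p : nat, [/\ prime p, ~ A p%:R^-1 &
  forall n : nat, coprime p n -> A n%:R^-1].
Proof.
have ex : exists n, (0 < n)%N && ~~ `[< A n%:R^-1 >].
  by have [n [n0 nA]] := nonunit_nat; exists n; rewrite n0; apply/asboolPn.
case: (ex_minnP ex) => p /andP[p0 /asboolPn nAp] min.
have pr : prime p.
  apply/primeP; split.
    rewrite ltn_neqAle p0 andbT; apply/negP => /eqP e; apply: nAp.
    by rewrite -e invr1; apply: subr_1.
  move=> k kp; apply: contraT => /norP[k1 kn]; exfalso; apply: nAp.
  have kdv := dvdn_leq p0 kp; have k0 : (0 < k)%N := dvdn_gt0 p0 kp.
  have small l : (0 < l)%N -> (l < p)%N -> A l%:R^-1.
    move=> l0 lp; apply: contrapT => n; have := min l; rewrite l0 /=.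
    by move=> /(_ (introN (asboolP _) n)); rewrite leqNgt lp.
  rewrite -(divnK kp) natrM invfM; apply: subr_M => //; apply: small => //.
  - by rewrite divn_gt0.
  - by rewrite ltn_Pdiv //; lia.
  - by rewrite ltn_neqAle kn.
exists p; split=> // n cop.
have n0 : (0 < n)%N.
  by rewrite lt0n; apply/negP => /eqP e; move: cop; rewrite e /coprime gcdn0 => /eqP e'; rewrite e' in pr.
have nK := @natr_extQ_neq0 K n n0; have pK := @natr_extQ_neq0 K p p0.
have [u w e _] := egcdnP p n0.
have {e} e : (u * n)%:R = (w * p)%:R + 1 :> K.
  by rewrite e gcdnC (eqP cop) natrD.
rewrite !natrM in e.
case: (valA (p%:R / n%:R)) => [pn|]; last rewrite invf_div => np.
  have -> : n%:R^-1 = u%:R - w%:R * (p%:R / n%:R) :> K.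
    by apply: (mulIf nK); rewrite mulVf // mulrBl e mulrA divfK // addrC addKr.
  by apply: subr_B => //; [|apply: subr_M => //]; apply: subr_nat.
exfalso; apply: nAp.
have -> : p%:R^-1 = u%:R * (n%:R / p%:R) - w%:R :> K.
  by apply: (mulIf pK); rewrite mulVf // mulrBl mulrA divfK // e addrC addKr.
by apply: subr_B => //; [apply: subr_M => //|]; apply: subr_nat.
Qed.

End ValuationRing.

Section Valuation.
Variables (K : fieldExtType rat) (R : realType) (A : set K).
Hypotheses (sA : is_subring A) (valA : forall y, A y \/ A y^-1).

(** Divisible by every positive difference of exponents up to the degree, so that the value of
    [z ^+ c] is an integral multiple of that of [p]. *)
Let c := (\dim {:K})`!.

Variable p : nat.
Hypotheses (pr : prime p) (nAp : ~ A p%:R^-1) (copA : forall n : nat, coprime p n -> A n%:R^-1).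

Let P : K := p%:R.

Let P0 : P != 0. Proof. by apply: natr_extQ_neq0; apply: prime_gt0. Qed.

Lemma assoc_nat n : (0 < n)%N -> assoc A n%:R (P ^+ logn p n).
Proof.
move=> n0; have [m cop e] := pfactor_coprime pr n0.
have m0 : (m%:R : K) != 0.
  by apply: natr_extQ_neq0; rewrite lt0n; apply: contraTneq n0 => m0; rewrite e m0.
have nE : n%:R = m%:R * P ^+ logn p n :> K by rewrite {1}e natrM natrX.
split; rewrite nE.
  by rewrite mulfK ?expf_neq0 //; apply: subr_nat.
by rewrite invfM mulrCA mulfV ?expf_neq0 // mulr1; apply: copA.
Qed.

Lemma assoc_int (k : int) : k != 0 -> exists a : nat, assoc A k%:~R (P ^+ a).
Proof.
move=> k0; exists (logn p (absz k)); have [a b] := @assoc_nat (absz k) ltac:(by rewrite absz_gt0).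
have [->|->] : (k = absz k \/ k = - (absz k : int)) by lia.
  by rewrite absz_nat.
by rewrite abszN absz_nat rmorphN; split; rewrite ?invrN ?mulrN ?mulNr; apply: subr_N.
Qed.

Lemma A_expz (n : int) : A (P ^ n) -> 0 <= n.
Proof.
case: n => // n An; exfalso; apply: nAp; rewrite -/P.
have -> : P^-1 = P ^+ n * P ^ Negz n.
  by rewrite NegzE -exprnN exprS invfM mulrCA mulfV ?expf_neq0 // mulr1.
by apply: subr_M => //; apply: subr_X => //; apply: subr_nat.
Qed.

Lemma assoc_expz_inj (n k : int) : assoc A (P ^ n) (P ^ k) -> n = k.
Proof.
rewrite /assoc !invr_expz -!expfzDr // => [[/A_expz a /A_expz b]].
by apply/eqP; rewrite eq_le -subr_ge0 b -subr_ge0 a.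
Qed.

(** In an integer relation for [z], a term of largest value must be matched by another, else the sum
    could not vanish. Comparing the terms of exponents i < j expresses the value of z^(j - i)
    through [p], and j - i divides [c]. *)
Lemma value_exists z : z != 0 -> exists n : int, assoc A (z ^+ c) (P ^ n).
Proof.
move=> z0; have [q [q0 sq rq]] := int_poly_root z.
pose T i := (q`_i)%:~R * z ^+ i.
pose I := [seq i <- iota 0 (size q) | q`_i != 0].
have T0 i : i \in I -> T i != 0.
  rewrite mem_filter => /andP[qi _]; rewrite mulf_neq0 ?expf_neq0 //.
  by rewrite -(rmorph0 (intr : int -> K)) (inj_eq (@intr_extQ_inj K)).
have sumT : \sum_(i <- I) T i = 0.
  move/rootP: rq; rewrite horner_coef size_map_inj_poly ?rmorph0 //; last exact: intr_extQ_inj.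
  move=> e; rewrite -[RHS]e big_filter big_mkcond /=.
  rewrite -(big_mkord xpredT (fun i => (map_poly intr q)`_i * z ^+ i)).
  rewrite /index_iota subn0; apply: eq_bigr => i _; rewrite coef_map /= /T.
  by case: eqP => // ->; rewrite mul0r.
have [||_ /mapP[i iI ->] max] := @max_term _ A sA valA (map T I) _ _.
- by move=> _ /mapP[i iI ->]; apply: T0.
- rewrite -size_eq0 size_map size_eq0; apply/eqP => I0.
  have : (size q).-1 \in I.
    rewrite mem_filter -lead_coefE lead_coef_eq0 q0 mem_iota /= add0n.
    by rewrite prednK // lt0n size_poly_eq0.
  by rewrite I0.
have [j jI [ji TT]] : exists2 j, j \in I & j != i /\ assoc A (T i) (T j).
  apply: contrapT => none.
  have [|_] := @nonunit_sum _ A sA valA _ [seq j <- I | j != i] (fun j => T j / T i).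
    move=> j; rewrite mem_filter => /andP[ji jI]; split; first by apply: max; apply: map_f.
    rewrite invf_div => _ Aji; apply: none; exists j => //; split=> //; split=> //.
    by apply: max; apply: map_f.
  rewrite -mulr_suml; have -> : \sum_(j <- [seq j <- I | j != i]) T j = - T i.
    apply/eqP; rewrite -addr_eq0 addrC big_filter -(bigD1_seq i) ?sumT //=.
    by rewrite filter_uniq // iota_uniq.
  rewrite mulNr mulfV ?T0 // oppr_eq0 oner_eq0 invrN1 => /(_ isT); apply.
  by apply: subr_N => //; apply: subr_1.
have {TT} [i' [j' [lt jd [a [b ab]]]]] : exists i', exists j', [/\ (i' < j')%N, (j' <= \dim {:K})%N &
    exists a b : nat, assoc A (P ^+ a * z ^+ i') (P ^+ b * z ^+ j')].
  have wl i1 j1 : i1 \in I -> j1 \in I -> assoc A (T i1) (T j1) -> (j1 <= \dim {:K})%N /\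
     exists a b : nat, assoc A (P ^+ a * z ^+ i1) (P ^+ b * z ^+ j1).
    rewrite !mem_filter !mem_iota => /andP[qi iq] /andP[qj /andP[_ jq]] hT; split.
      by rewrite -ltnS; apply: leq_trans sq.
    have [a Ha] := assoc_int qi; have [b Hb] := assoc_int qj; exists a, b.
    have zz k : assoc A (z ^+ k) (z ^+ k) by apply: (assoc_refl sA); apply: expf_neq0.
    apply: (@assoc_trans _ _ sA _ (T i1)); first by apply: T0; rewrite mem_filter qi mem_iota.
      by apply: assocM => //; apply: assoc_sym.
    apply: (@assoc_trans _ A sA _ (T j1)) hT _; last by apply: assocM.
    by apply: T0; rewrite mem_filter qj mem_iota.
  case: (ltngtP i j) ji => // ij _.
    by have [jd ab] := wl _ _ iI jI TT; exists i, j.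
  by have [jd ab] := wl _ _ jI iI (assoc_sym TT); exists j, i.
have e1 : assoc A (z ^+ (j' - i')) (P ^ (a%:Z - b%:Z)).
  apply: (@assocMl _ A _ _ (P ^+ b)); first exact: expf_neq0.
  apply: (@assocMl _ A _ _ (z ^+ i')); first exact: expf_neq0.
  apply: assoc_sym; move: ab.
  have -> : z ^+ i' * (P ^+ b * z ^+ (j' - i')) = P ^+ b * z ^+ j'.
    by rewrite mulrCA -exprD subnKC // ltnW.
  suff -> : P ^+ b * P ^ (a%:Z - b%:Z) = P ^+ a by rewrite mulrC.
  by rewrite [P ^+ b]exprnP -expfzDr // addrC subrK.
exists ((a%:Z - b%:Z) * (c %/ (j' - i'))%N%:Z).
have cE : (c = (j' - i') * (c %/ (j' - i')))%N.
  by rewrite mulnC divnK // dvdn_fact // subn_gt0 lt /= (leq_trans (leq_subr _ _)).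
by rewrite {1}cE exprM -exprz_exp -exprnP; apply: assocX.
Qed.

Lemma exists_valuation : exists2 v : K -> R, disc_val c v & forall y, A y <-> v y <= 1.
Proof.
have c0 : (0 < c)%N by apply: fact_gt0.
have /choice[f fE] : forall z, exists n : int, z != 0 -> assoc A (z ^+ c) (P ^ n).
  by move=> z; have [->|/value_exists[n H]] := eqVneq z 0; [exists 0|exists n].
(* Base 2 serves every [p]: values are integral powers of 2, which gives the gap above 1, and
   [2 <= p] gives the bound at integers. *)
pose v z : R := if z == 0 then 0 else 2 ^ (- f z).
have two : (2 : R) != 0 by [].
have f_uniq z n : z != 0 -> assoc A (z ^+ c) (P ^ n) -> f z = n.
  move=> z0 H; apply: assoc_expz_inj; apply: (@assoc_trans _ _ sA _ (z ^+ c)) => //.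
    exact: expf_neq0.
  by apply: assoc_sym; apply: fE.
have fM z t : z != 0 -> t != 0 -> f (z * t) = f z + f t.
  move=> z0 t0; apply: f_uniq; first exact: mulf_neq0.
  by rewrite exprMn expfzDr //; apply: (assocM sA); apply: fE.
have v_ge0 z : 0 <= v z by rewrite /v; case: eqP => // _; rewrite exprz_ge0.
have v_eq0 z : (v z == 0) = (z == 0).
  by rewrite /v; have [_|z0] := eqVneq z 0; rewrite ?eqxx // expfz_eq0 (negPf two) andbF.
have vM z t : v (z * t) = v z * v t.
  rewrite /v; have [->|z0] := eqVneq z 0; first by rewrite mul0r eqxx mul0r.
  have [->|t0] := eqVneq t 0; first by rewrite mulr0 eqxx mulr0.
  by rewrite mulf_eq0 (negPf z0) (negPf t0) /= fM // opprD expfzDr.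
have vA z : A z <-> v z <= 1.
  rewrite /v; have [->|z0] := eqVneq z 0; first by split=> // _; apply: subr_0.
  rewrite -(expr0z (2 : R)) ler_eXz2l ?ltr1n // oppr_le0; have [a b] := fE z z0; split.
    move=> Az; apply: A_expz; rewrite -(mulfK (expf_neq0 c z0) (P ^ f z)) mulrAC.
    by apply: subr_M => //; apply: subr_X.
  move=> fz; have Azc : A (z ^+ c).
    rewrite -(divfK (expfz_neq0 (f z) P0) (z ^+ c)); apply: subr_M => //.
    by case: (f z) fz => // k _; apply: subr_X => //; apply: subr_nat.
  case: (valA z) => // AVz; rewrite -(prednK c0) in Azc.
  have -> : z = z ^+ c.-1.+1 * z^-1 ^+ c.-1.
    by rewrite exprS exprVn mulfK ?expf_neq0.
  by apply: subr_M => //; apply: subr_X.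
have v_ultra z t : v (z + t) <= Num.max (v z) (v t).
  wlog le : z t / v t <= v z => [hw|].
    by case/orP: (le_total (v t) (v z)) => [/hw//|/hw]; rewrite addrC maxC.
  have [z0|z0] := eqVneq z 0.
    by rewrite z0 add0r le_max lexx orbT.
  have vz0 : 0 < v z by rewrite lt0r v_eq0 z0 v_ge0.
  have v1 : v 1 = 1.
    by apply: (mulfI (lt0r_neq0 vz0)); rewrite -vM !mulr1.
  rewrite max_l // -(divfK z0 (z + t)) vM ler_piMl //.
  apply/vA; rewrite mulrDl mulfV //; apply: subr_D => //; first exact: subr_1.
  apply/vA; rewrite -(ler_pM2r vz0) -vM divfK // mul1r //.
exists v => //; split=> //.
- split=> // z t; apply: (le_trans (v_ultra z t)).
  by rewrite ge_max lerDl lerDr !v_ge0.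
- move=> z; rewrite /v; case: eqP => [_|_]; first by rewrite ltr10.
  rewrite -{1}(expr0z (2 : R)) ltr_eXz2l ?ltr1n // => lt.
  by rewrite -{1}(expr1z (2 : R)) ler_eXz2l ?ltr1n // -gtz0_ge1.
- move=> n n0; rewrite /v (negPf (@natr_extQ_neq0 K n n0)).
  have -> : f n%:R = (logn p n * c)%N.
    apply: f_uniq; first exact: natr_extQ_neq0.
    by rewrite -exprnP exprM; apply: assocX => //; apply: assoc_nat.
  rewrite -exprnN mulrC -ler_pdivrMr ?div1r ?invrK; last by rewrite invr_gt0 exprn_gt0.
  rewrite exprM ler_pXn2r ?nnegrE ?exprn_ge0 // -natrX ler_nat.
  apply: (@leq_trans (p ^ logn p n)); first by case: (logn p n) => // k; rewrite leq_exp2r // prime_gt1.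
  exact/dvdn_leq/pfactor_dvdnn.
Qed.

End Valuation.

(** Together with [disc_val_integral], this tests integrality on discrete valuations alone. *)
Lemma exists_disc_val (K : fieldExtType rat) (R : realType) (x : K) :
  ~ integralOver (intr : int -> K) x ->
  exists2 v : K -> R, disc_val (\dim {:K})`! v & 1 < v x.
Proof.
move=> nint; have x0 : x != 0.
  by apply/eqP => x0; apply: nint; rewrite x0; apply: (mxpoly.integral0 (intr : {rmorphism int -> K})).
have [A [sA At nAx] maxA] := exists_maximal_subring x0 nint.
have valA := maximal_valuation x0 sA At nAx maxA.
have [p [pr nAp copA]] := nonunit_prime sA valA x0 At nAx.
have [v dv vA] := exists_valuation R sA valA pr nAp copA.
by exists v => //; rewrite ltNge; apply/negP => /vA.
Qed.

Lemma disc_val_integral (K : fieldType) (R : realType) c (v : K -> R) x :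
  disc_val c v -> integralOver (intr : int -> K) x -> v x <= 1.
Proof.
move=> [av ultra _ _] [p mp rp]; rewrite leNgt; apply/negP => v1.
have vz (k : int) : v k%:~R <= 1.
  by case: k => k; [exact: av_nat_le1|rewrite NegzE mulrNz avN //; exact: av_nat_le1].
have x0 : x != 0 by apply: contraTneq v1 => ->; rewrite av0 // ltr10.
have vx0 : 0 < v x by rewrite av_gt0.
move/rootP: rp; rewrite (@horner_coef_wide _ (size p)) ?size_poly //.
have: (0 < size p)%N by rewrite lt0n size_poly_eq0 monic_neq0.
case E : (size p) => [//|n] _.
rewrite big_ord_recr /= coef_map /=.
have -> : p`_n = 1 by have /monicP := mp; rewrite lead_coefE E.
rewrite mul1r => /eqP; rewrite addrC addr_eq0 => /eqP e.
case: n E e => [|n] E e.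
  by move/eqP: e; rewrite big_ord0 oppr0 expr0 oner_eq0.
have : v (x ^+ n.+1) <= v x ^+ n.
  rewrite e avN //; apply: av_ultra_sum => // [|i _]; first by rewrite exprn_ge0 ?av_ge0.
  rewrite coef_map /= avM // avX // -[X in _ <= X]mul1r; apply: ler_pM; rewrite ?exprn_ge0 ?av_ge0 //.
  by apply: ler_weXn2l; [exact: ltW|rewrite -ltnS].
by rewrite avX // exprS ger_pMl ?exprn_gt0 // leNgt v1.
Qed.

(** * Complex embeddings and Liouville inequalities *)

Lemma rat_integral (r : rat) (p : {poly int}) :
  p \is monic -> root (map_poly intr p) r -> exists k : int, r = k%:~R.
Proof.
move=> mp rp; have := rp; rewrite /root => /eqP.
have : (0 < size p)%N by rewrite lt0n size_poly_eq0 monic_neq0.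
rewrite (@horner_coef_wide _ (size p)) ?size_poly //; case E : (size p) => [//|n] _.
set a := numq r; set b := denq r.
have b0 : (b%:~R : rat) != 0 by rewrite intr_eq0 denq_eq0.
have rE : r = a%:~R / b%:~R by rewrite divq_num_den.
move=> e; have {}e : (\sum_(i < n.+1) p`_i * a ^+ i * b ^+ (n - i)) = 0.
  apply: (@intr_inj rat); rewrite rmorph0 -[RHS](mul0r (b%:~R ^+ n)) -{}e.
  rewrite rmorph_sum mulr_suml; apply: eq_bigr => i _; rewrite coef_map /=.
  rewrite !rmorphM /= !rmorphXn /= rE exprMn -!mulrA; congr (_ * (_ * _)).
  by apply: (mulfI (expf_neq0 i b0)); rewrite -exprD subnKC -1?ltnS // exprVn mulVKf ?expf_neq0.
have dv : (b %| a ^+ n)%Z.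
  move/eqP: e; rewrite big_ord_recr /= subnn expr0 mulr1.
  have -> : p`_n = 1 by have /monicP := mp; rewrite lead_coefE E.
  rewrite mul1r addrC addr_eq0 => /eqP ->; rewrite rpredN; apply: rpred_sum => i _.
  by rewrite dvdz_mull // -(subnSK (ltn_ord i)) exprS dvdz_mulr.
have cop : coprimez b (a ^+ n) by rewrite coprimezE abszX coprimeXr // coprime_sym coprime_num_den.
have b1 : (b %| 1)%Z by rewrite -(Gauss_dvdzr 1 cop) mulr1.
have : b = 1 by have := denq_gt0 r; move: b1; rewrite dvdz1 -/b; lia.
by rewrite rE => ->; exists a; rewrite divr1.
Qed.

Section IntegralOverInt.
Variable F : fieldType.
Local Notation intF := (integralOver (intr : int -> F)).

Lemma intZ_nat k : intF k%:R.
Proof. exact: (mxpoly.integral_nat (intr : {rmorphism int -> F})). Qed.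

Lemma intZ_M x y : intF x -> intF y -> intF (x * y).
Proof. exact: (mxpoly.integral_mul (RtoK := (intr : {rmorphism int -> F}))). Qed.

Lemma intZ_D x y : intF x -> intF y -> intF (x + y).
Proof. exact: (mxpoly.integral_add (RtoK := (intr : {rmorphism int -> F}))). Qed.

Lemma intZ_N x : intF x -> intF (- x).
Proof. exact: (mxpoly.integral_opp (RtoK := (intr : {rmorphism int -> F}))). Qed.

Lemma intZ_prod (I : eqType) (r : seq I) (f : I -> F) :
  (forall i, i \in r -> intF (f i)) -> intF (\prod_(i <- r) f i).
Proof.
elim: r => [_|i r IH H]; first by rewrite big_nil; apply: intZ_nat 1%N.
rewrite big_cons; apply: intZ_M; first by apply: H; rewrite mem_head.
by apply: IH => j jr; apply: H; rewrite inE jr orbT.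
Qed.

Lemma intZ_X x k : intF x -> intF (x ^+ k).
Proof.
by move=> ix; elim: k => [|k IH]; [apply: intZ_nat 1%N|rewrite exprS; apply: intZ_M].
Qed.

End IntegralOverInt.

Section Embeddings.
Variables (K : fieldExtType rat) (R : realType).
Local Notation C := (R[i]).
Local Notation n := (\dim {:K}).
Let b := vbasis {:K}.

Let bE (x : K) : x = \sum_i coord b i x *: b`_i.
Proof. by apply: coord_basis (vbasisP _) _; rewrite memvf. Qed.

(** The regular representation on row vectors; its characteristic polynomial carries the conjugates
    and the norm of [x]. *)
Definition regmx (x : K) : 'M[rat]_n := \matrix_(i, j) coord b j (b`_i * x).

Lemma regmxM x y : regmx (x * y) = regmx x *m regmx y.
Proof.
apply/matrixP => i k; rewrite !mxE mulrA {1}[b`_i * x]bE mulr_suml linear_sum /=.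
by apply: eq_bigr => j _; rewrite !mxE -scalerAl linearZ.
Qed.

Lemma regmx1 : regmx 1 = 1%:M.
Proof.
apply/matrixP => i j; rewrite !mxE mulr1 coord_free ?eqxx //.
exact: basis_free (vbasisP _).
Qed.

Lemma regmxE x : regmx x = \sum_i coord b i x *: regmx b`_i.
Proof.
apply/matrixP => i j; rewrite mxE {1}[x]bE mulr_sumr linear_sum summxE /=.
by apply: eq_bigr => k _; rewrite !mxE -scalerAr linearZ.
Qed.

Lemma regmx_comm x y : comm_mx (map_mx (ratr : rat -> C) (regmx x)) (map_mx ratr (regmx y)).
Proof. by rewrite /comm_mx -!map_mxM -!regmxM mulrC. Qed.

(* A common eigenvector of the commuting matrices [regmx z] is a ring morphism [z |-> eigenvalue]. *)
Lemma exists_embedding (x : K) (a : C) :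
  root (map_poly ratr (char_poly (regmx x))) a -> exists s : {rmorphism K -> C}, s x = a.
Proof.
rewrite map_char_poly -eigenvalue_root_char => ev.
pose M z := map_mx (ratr : rat -> C) (regmx z).
have MM z t : M (z * t) = M z *m M t by rewrite /M regmxM map_mxM.
have ME z : M z = \sum_i ratr (coord b i z) *: M b`_i.
  by rewrite /M {1}regmxE map_mx_sum; apply: eq_bigr => i _; rewrite map_mxZ.
have M1 : M 1 = 1%:M by rewrite /M regmx1 map_mx1.
have Mcomm z t : comm_mx (M z) (M t) by exact: regmx_comm.
have {}ev : eigenvalue (M x) a := ev.
clearbody M.
pose W := eigenspace (M x) a.
have st z : stablemx W (M z) by apply: comm_mx_stable_eigenspace.
have rM A B : stablemx W A -> stablemx W B ->
    restrictmx W (A *m B) = restrictmx W A *m restrictmx W B.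
  by move=> sA sB; rewrite conjmxM ?inE ?stablemx_row_base.
have [] := @common_eigenvector C _ [seq restrictmx W (M b`_i) | i : 'I_n].
- by rewrite lt0n mxrank_eq0.
- move=> _ _ /mapP[i _ ->] /mapP[j _ ->].
  by rewrite /comm_mx -!rM // Mcomm.
move=> v0 v0N /allP /= v0P; pose v := v0 *m row_base W.
have vN : v != 0 by rewrite mulmx_free_eq0 ?row_base_free.
have vx : v *m M x = a *: v.
  by apply/eigenspaceP; rewrite mulmx_sub // eq_row_base.
have /choice[l lE] : forall i : 'I_n, exists l : C, v *m M b`_i = l *: v.
  move=> i; have /eigenvectorP[l /eigenspaceP e] : stablemx v (M b`_i).
    rewrite -stablemx_restrict //.
    by apply: v0P; apply/mapP; exists i; rewrite ?mem_enum.
  by exists l.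
pose f z := \sum_i ratr (coord b i z) * l i.
have fE z : v *m M z = f z *: v.
  rewrite ME mulmx_sumr scaler_suml; apply: eq_bigr => i _.
  by rewrite -scalemxAr lE scalerA.
have inj (c e : C) : c *: v = e *: v -> c = e.
  move/eqP; rewrite -subr_eq0 -scalerBl scaler_eq0 (negPf vN) orbF subr_eq0.
  by move/eqP.
have fB : zmod_morphism f.
  move=> z t; rewrite /f -sumrB; apply: eq_bigr => i _.
  by rewrite linearB rmorphB mulrBl.
have fM : monoid_morphism f.
  split; first by apply: inj; rewrite -fE M1 mulmx1 scale1r.
  move=> z t; apply: inj; rewrite -fE MM mulmxA fE -scalemxAl fE scalerA //.
pose addf := GRing.isZmodMorphism.Build K C f fB.
pose mulf := GRing.isMonoidMorphism.Build K C f fM.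
pose s : {rmorphism K -> C} := HB.pack f addf mulf.
by exists s; apply: inj; rewrite -[s x]/(f x) -fE.
Qed.

(** The vector of basis elements is an eigenvector over [K] of the transpose, with eigenvalue
    [x]. *)
Lemma root_char_regmx (x : K) : root (map_poly (in_alg K) (char_poly (regmx x))) x.
Proof.
rewrite map_char_poly -eigenvalue_root_char.
suff: \det (map_mx (in_alg K) (regmx x) - x%:M)^T == 0.
  rewrite det_tr => /det0P[v v0 /eqP]; rewrite mulmxBr subr_eq0 mul_mx_scalar => /eqP e.
  by apply/eigenvalueP; exists v.
apply/det0P; exists (\row_j b`_j).
  apply/eqP => /rowP z; have := oner_neq0 K; rewrite [1]bE big1 ?eqxx // => i _.
  by have := z i; rewrite !mxE => ->; rewrite scaler0.
apply/rowP => i; rewrite linearB /= mulmxBr tr_scalar_mx mul_mx_scalar !mxE.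
apply/eqP; rewrite subr_eq0 [x * _]mulrC; apply/eqP; rewrite [RHS]bE; apply: eq_bigr => j _.
by rewrite !mxE /= mulr_algr.
Qed.

Lemma rmorph_root_char (s : {rmorphism K -> C}) x :
  root (map_poly ratr (char_poly (regmx x))) (s x).
Proof.
have := root_char_regmx x; rewrite -(fmorph_root s) -map_poly_comp.
by rewrite (eq_map_poly (fmorph_eq_rat (s \o in_alg K))).
Qed.

Lemma integral_rmorphE (s : {rmorphism K -> C}) x :
  integralOver (intr : int -> C) (s x) <-> integralOver (intr : int -> K) x.
Proof.
have E (p : {poly int}) : root (map_poly intr p) (s x) = root (map_poly intr p) x.
  rewrite -(fmorph_root s) -map_poly_comp; congr (root _ _).
  by apply: eq_map_poly => k /=; rewrite rmorph_int.
by split=> [[p mp rp]|[p mp rp]]; exists p => //; move: rp; rewrite E.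
Qed.

Lemma conjugates (x : K) : exists ys : seq C, [/\ size ys = n,
  map_poly ratr (char_poly (regmx x)) = \prod_(y <- ys) ('X - y%:P),
  forall y, y \in ys -> exists s : {rmorphism K -> C}, s x = y
  & forall s : {rmorphism K -> C}, s x \in ys].
Proof.
have [ys E] := closed_field_poly_normal (map_poly (ratr : rat -> C) (char_poly (regmx x))).
have /monicP m1 : map_poly (ratr : rat -> C) (char_poly (regmx x)) \is monic.
  by rewrite map_monic char_poly_monic.
rewrite m1 scale1r in E; exists ys; split=> //.
- have := size_char_poly (regmx x); rewrite -(size_map_poly (ratr : {rmorphism rat -> C})) E.
  by rewrite size_prod_XsubC => [[]].
- by move=> y yys; apply: exists_embedding; rewrite E root_prod_XsubC.
- by move=> s; have := rmorph_root_char s x; rewrite E root_prod_XsubC.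
Qed.

Import Normc.

Lemma absolute_value_normc (s : {rmorphism K -> C}) : absolute_value (fun x => normc (s x)).
Proof.
split=> [x|x|x y|x y].
- by case: (s x) => p q; rewrite /normc sqrtr_ge0.
- apply/eqP/eqP => [/eq0_normc/eqP|->]; last by rewrite rmorph0 normc0.
  by rewrite fmorph_eq0 => /eqP.
- by rewrite rmorphM normcM.
- by rewrite rmorphD; apply: le_normcD.
Qed.

Lemma normc_nat (k : nat) : normc (k%:R : C) = k%:R.
Proof.
elim: k => [|k IH]; first exact: normc0.
have -> : (k.+1%:R : C) = (k.+1%:R : R)%:C%C by rewrite rmorph_nat.
by rewrite /normc /= expr0n /= addr0 sqrtr_sqr ger0_norm.
Qed.

(** [k] is the absolute value of the norm, which is rational and integral, hence an integer. The
    cofactor [z] is, up to sign, the product of the other conjugates, hence integral. *)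
Lemma integral_norm (x : K) : x != 0 -> integralOver (intr : int -> K) x ->
  exists k : nat, exists z : K, exists ys : seq C,
  [/\ (0 < k)%N, integralOver (intr : int -> K) z, k%:R = x * z, size ys = n
    & [/\ k%:R = \prod_(y <- ys) normc y,
      forall y, y \in ys -> exists s : {rmorphism K -> C}, s x = y
      & forall s : {rmorphism K -> C}, s x \in ys]].
Proof.
move=> x0 intx; have [ys [sz E H1 H2]] := conjugates x.
have inty y : y \in ys -> integralOver (intr : int -> C) y.
  by move=> /H1[s <-]; apply/integral_rmorphE.
pose r : rat := (-1) ^+ n * (char_poly (regmx x))`_0.
have rE : ratr r = \prod_(y <- ys) y.
  rewrite rmorphM rmorphXn rmorphN1 /= -coef_map E -horner_coef0 horner_prod -sz.
  have -> : \prod_(y <- ys) ('X - y%:P).[0] = (-1) ^+ size ys * \prod_(y <- ys) y.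
    elim: ys {sz E H1 H2 inty} => [|y ys IH]; rewrite ?big_nil ?mulr1 //.
    by rewrite !big_cons IH hornerXsubC /= exprS; ring.
  by rewrite mulrA -expr2 sqrr_sign mul1r.
have [k rk] : exists k : int, r = k%:~R.
  have [p mp rp] : integralOver (intr : int -> C) (ratr r).
    by rewrite rE; apply: intZ_prod.
  apply: (rat_integral mp); rewrite -(fmorph_root (ratr : {rmorphism rat -> C})) -map_poly_comp.
  by move: rp; congr (root _ _); apply: eq_map_poly => j /=; rewrite ratr_int.
rewrite rk ratr_int in rE.
have sgn : exists e : int, [/\ e = 1 \/ e = -1 & (absz k : int) = e * k].
  by have [le|lt] := lerP 0 k; [exists 1|exists (-1)]; split; [left|lia|right|lia].
have [e [e1 ek]] := sgn.
have kC : ((absz k)%:R : C) = e%:~R * \prod_(y <- ys) y.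
  by rewrite -rE -rmorphM -ek.
have y0 y : y \in ys -> y != 0 by move=> /H1[s <-]; rewrite fmorph_eq0.
have k0 : (0 < absz k)%N.
  rewrite absz_gt0; apply/eqP => k0; move/eqP: rE; rewrite k0 eq_sym prodf_seq_eq0.
  by case/hasP => y /y0; rewrite /= => /negPf ->.
have [y1 y1s] : exists y, y \in ys.
  have : (0 < size ys)%N by rewrite sz; exact: (adim_gt0 {:K}%AS).
  by case: (ys) => // y ?; exists y; rewrite mem_head.
have [s sx] := H1 _ y1s.
exists (absz k), ((absz k)%:R / x), ys; split=> //.
- apply/(integral_rmorphE s); rewrite fmorph_div rmorph_nat sx kC (big_rem y1) //=.
  rewrite [y1 * _]mulrC mulrA mulfK ?y0 //; apply: intZ_M.
    by case: e1 => ->; rewrite ?rmorphN; [|apply: intZ_N]; apply: intZ_nat 1%N.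
  by apply: intZ_prod => y /mem_rem; apply: inty.
- by rewrite mulrC divfK.
split=> //; rewrite -normc_nat kC normcM.
have -> : normc (e%:~R : C) = 1.
  by case: e1 => ->; rewrite ?rmorphN ?normcN; apply: (normc_nat 1).
rewrite mul1r; elim: (ys) => [|y zs IH]; rewrite ?big_nil; first exact: (normc_nat 1).
by rewrite !big_cons normcM IH.
Qed.

End Embeddings.

(** * Lower bounds for integral elements, and a place where [q] is large *)

Section GoodPlace.
Variables (K : fieldExtType rat) (R : realType).
Local Notation C := (R[i]).
Local Notation n := (\dim {:K}).
Local Notation intK := (integralOver (intr : int -> K)).
Import Normc.

Lemma normc_ge0 (z : C) : 0 <= normc z.
Proof. by case: z => p q; rewrite /normc sqrtr_ge0. Qed.

Lemma prod_normc_le (ys : seq C) (B : R) : (forall y, y \in ys -> normc y <= B) ->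
  \prod_(y <- ys) normc y <= B ^+ size ys.
Proof.
elim: ys => [_|y ys IH H]; first by rewrite big_nil.
rewrite big_cons exprS; apply: ler_pM; rewrite ?normc_ge0 ?H ?mem_head //.
  by apply: prodr_ge0 => *; apply: normc_ge0.
by apply: IH => z zs; apply: H; rewrite inE zs orbT.
Qed.

Lemma norm_lower (x : K) (B : R) : intK x -> x != 0 ->
  (forall s : {rmorphism K -> C}, normc (s x) <= B) -> 1 <= B ^+ n.
Proof.
move=> ix x0 H; have [k [z [ys [k0 iz kE sz [kP H1 H2]]]]] := integral_norm R x0 ix.
apply: (@le_trans _ _ k%:R); first by rewrite ler1n.
rewrite kP -sz; apply: prod_normc_le => y /H1[s <-]; exact: H.
Qed.

Lemma liouville_arch (s0 : {rmorphism K -> C}) (x : K) (B : R) : 1 <= B -> intK x -> x != 0 ->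
  (forall s : {rmorphism K -> C}, normc (s x) <= B) -> 1 <= normc (s0 x) * B ^+ n.
Proof.
move=> B1 ix x0 H; have [k [z [ys [k0 iz kE sz [kP H1 H2]]]]] := integral_norm R x0 ix.
apply: (@le_trans _ _ k%:R); first by rewrite ler1n.
rewrite kP (big_rem (s0 x)) //=; apply: ler_wpM2l; first exact: normc_ge0.
apply: (@le_trans _ _ (B ^+ size (rem (s0 x) ys))).
  by apply: prod_normc_le => y /mem_rem/H1[s <-].
by apply: ler_weXn2l => //; rewrite -sz size_rem // leq_pred.
Qed.

(** [x] divides its norm [k], so [v k <= v x]; moreover [v k] is at least [k] to the power -c, and
    [k <= B ^+ n]. *)
Lemma liouville_disc c (v : K -> R) (x : K) (B : R) : disc_val c v ->
  1 <= B -> intK x -> x != 0 ->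
  (forall s : {rmorphism K -> C}, normc (s x) <= B) -> 1 <= v x * B ^+ (n * c).
Proof.
move=> dv B1 ix x0 H; have [k [z [ys [k0 iz kE sz [kP H1 H2]]]]] := integral_norm R x0 ix.
have [av ultra _ vn] := dv; apply: (le_trans (vn _ k0)).
apply: ler_pM; rewrite ?(av_ge0 av) ?exprn_ge0 //.
  by rewrite kE avM // ler_piMr ?av_ge0 // (disc_val_integral dv).
rewrite exprM lerXn2r ?nnegrE ?exprn_ge0 ?(le_trans ler01 B1) //.
by rewrite kP -sz; apply: prod_normc_le => y /H1[s <-].
Qed.

(** Cells of length 1/4 on [-1, 1]: [4 * (t + 1)] runs from 0 to 8 inclusive, whence nine of
    them. *)
Let cell (t : R) : 'I_9 := inord (Num.truncn (4 * (t + 1))).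

Let cellP t u : `|t| <= 1 -> `|u| <= 1 -> cell t = cell u -> `|t - u| <= 4^-1.
Proof.
have tr (z : R) : `|z| <= 1 -> 0 <= 4 * (z + 1) /\ (Num.truncn (4 * (z + 1)) < 9)%N.
  rewrite ler_norml => /andP[a b]; have z0 : 0 <= 4 * (z + 1) by lra.
  split=> //; have /andP[le _] := truncn_itv z0; rewrite -(ltr_nat R).
  by apply: (le_lt_trans le); lra.
move=> /tr[t0 t9] /tr[u0 u9] /(congr1 val); rewrite /= !inordK // => e.
have /andP[a b] := truncn_itv t0; have /andP[c d] := truncn_itv u0; rewrite e in a b.
move: a b c d; move: (Num.truncn (4 * (u + 1))) => k; have -> : k.+1%:R = k%:R + 1 :> R by rewrite -natr1.
move=> a b c d.
by rewrite ler_norml; apply/andP; split; lra.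
Qed.

Let re_im_le (z : C) : normc z <= 1 -> `|complex.Re z| <= 1 /\ `|complex.Im z| <= 1.
Proof.
case: z => a b; rewrite /normc /= => H.
have H2 : a ^+ 2 + b ^+ 2 <= 1.
  rewrite -(sqr_sqrtr (_ : 0 <= a ^+ 2 + b ^+ 2)) ?addr_ge0 ?sqr_ge0 //.
  by rewrite exprn_ile1 ?sqrtr_ge0.
by split; rewrite -(expr_le1 (n := 2)) // real_normK ?num_real //;
   [have := sqr_ge0 b|have := sqr_ge0 a]; lra.
Qed.

Let normc_small (z : C) : `|complex.Re z| <= 4^-1 -> `|complex.Im z| <= 4^-1 -> normc z <= 2^-1.
Proof.
case: z => a b /=; rewrite !ler_norml => /andP[a1 a2] /andP[b1 b2].
have -> : (2^-1 : R) = Num.sqrt (2^-1 ^+ 2) by rewrite sqrtr_sqr ger0_norm // invr_ge0.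
by rewrite /normc ler_wsqrtr //; nra.
Qed.

(** Kronecker's theorem by pigeonhole: if no conjugate exceeded 1, two powers of [q] would agree
    within 1/2 at all embeddings, and their difference, nonzero and integral, would have norm below
    1. *)
Lemma kronecker (q : K) : q != 0 -> intK q -> (forall k : nat, (0 < k)%N -> q ^+ k != 1) ->
  exists s : {rmorphism K -> C}, 1 < normc (s q).
Proof.
move=> q0 iq qroot; apply: contrapT => none.
have H (s : {rmorphism K -> C}) : normc (s q) <= 1.
  by rewrite leNgt; apply/negP => lt; apply: none; exists s.
have [ys [sz _ H1 H2]] := conjugates R q.
have yX y k : y \in ys -> normc (y ^+ k) <= 1.
  move=> /H1[s <-]; rewrite -rmorphXn (avX (absolute_value_normc s)).
  by rewrite exprn_ile1 // normc_ge0.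
pose F (k : nat) : {ffun 'I_(size ys) -> 'I_9 * 'I_9} :=
  [ffun a : 'I_(size ys) => (cell (complex.Re (ys`_a ^+ k)), cell (complex.Im (ys`_a ^+ k)))].
have [i [j [ij Fij]]] : exists i j : nat, i != j /\ F i = F j.
  apply: contrapT => inj.
  have /leq_card : injective (fun k : 'I_(#|{: {ffun 'I_(size ys) -> 'I_9 * 'I_9}}|).+1 => F k).
    move=> i j Fij; apply/val_inj/eqP; apply: contrapT => /negP ij.
    by apply: inj; exists i, j.
  by rewrite card_ord ltnn.
have ix : intK (q ^+ i - q ^+ j) by apply: intZ_D; [|apply: intZ_N]; apply: intZ_X.
have x0 : q ^+ i - q ^+ j != 0.
  by rewrite subr_eq0; apply: contra_neq ij => /(exprn_nonroot_inj q0 qroot).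
have small (s : {rmorphism K -> C}) : normc (s (q ^+ i - q ^+ j)) <= 2^-1.
  have ys_s := H2 s; rewrite rmorphB !rmorphXn /=.
  have lt : (index (s q) ys < size ys)%N by rewrite index_mem.
  have := congr1 (fun f : {ffun _ -> _} => f (Ordinal lt)) Fij; rewrite !ffunE /= nth_index // => [[e1 e2]].
  have [a1 a2] := re_im_le (yX _ i ys_s); have [b1 b2] := re_im_le (yX _ j ys_s).
  by apply: normc_small; rewrite raddfB /=; exact: cellP.
have := norm_lower ix x0 small.
have : (0 < n)%N by exact: (adim_gt0 {:K}%AS).
case: n => // k _; rewrite exprS.
have : (2^-1 : R) ^+ k <= 1 by rewrite exprn_ile1 // invr_le1 ?unitfE // ler1n.
by move: (_ ^+ k) => t; lra.
Qed.

(** What the final estimate needs from its place, in a form common to archimedean and discrete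
    ones. *)
Definition good_place (v0 : K -> R) (kappa : nat) :=
  [/\ absolute_value v0,
    forall x B, 1 <= B -> intK x -> x != 0 ->
      (forall s : {rmorphism K -> C}, normc (s x) <= B) -> 1 <= v0 x * B ^+ kappa
    & forall x B, 1 <= B -> intK x ->
      (forall s : {rmorphism K -> C}, normc (s x) <= B) -> v0 x <= B].

Lemma exists_good_place (q : K) : q != 0 -> (forall k : nat, (0 < k)%N -> q ^+ k != 1) ->
  exists v0 : K -> R, exists2 kappa, good_place v0 kappa & 1 < v0 q.
Proof.
move=> q0 qroot; have [iq|/(@exists_disc_val K R)[v dv vq]] := pselect (intK q).
  have [s s1] := kronecker q0 iq qroot; exists (fun x => normc (s x)), n => //.
  split=> [|x B B1 ix x0 H|x B B1 ix H]; first exact: absolute_value_normc.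
    exact: liouville_arch.
  exact: H.
exists v, (n * n`!)%N => //; split=> [|x B B1 ix x0 H|x B B1 ix H]; first by case: dv.
  exact: liouville_disc.
by apply: le_trans B1; exact: (disc_val_integral dv ix).
Qed.

End GoodPlace.

(** * Growth of the partial sums *)

Lemma exists_denominator (K : fieldExtType rat) (x : K) :
  exists2 d : nat, (0 < d)%N & integralOver (intr : int -> K) (d%:R * x).
Proof.
have [p [p0 _ rp]] := int_poly_root x.
pose c := lead_coef p; have c0 : c != 0 by rewrite lead_coef_eq0.
suff ic : integralOver (intr : int -> K) (c%:~R * x).
  exists (absz c); first by rewrite absz_gt0.
  have [e|e] : (absz c : int) = c \/ (absz c : int) = - c by lia.
    by rewrite -[(absz c)%:R]/((absz c : int)%:~R) e.
  by rewrite -[(absz c)%:R]/((absz c : int)%:~R) e rmorphN mulNr; apply: intZ_N.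
have : (0 < size p)%N by rewrite lt0n size_poly_eq0.
case E : (size p) => [//|n] _.
case: n E => [|n] E.
  move: rp; have [a a0 ->] : exists2 a, a != 0 & p = a%:P by apply/size_poly1P; rewrite E.
  rewrite map_polyC rootC -(rmorph0 (intr : int -> K)) /= => /eqP/intr_extQ_inj.
  by move/eqP; rewrite (negPf a0).
pose r : {poly int} := 'X^(n.+1) + \poly_(i < n.+1) (p`_i * c ^+ (n - i)).
exists r.
  rewrite monicE /r lead_coefDl ?lead_coefXn // size_polyXn ltnS; exact: size_poly.
rewrite /r rmorphD /= map_polyXn rootE hornerD hornerXn.
rewrite (@horner_coef_wide _ n.+1); last by apply: (leq_trans (size_poly _ _)); exact: size_poly.
move/rootP: rp; rewrite (@horner_coef_wide _ n.+2) -?E ?size_poly // E big_ord_recr /= => e.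
have {}e : (\sum_(i < n.+1) (map_poly intr p)`_i * x ^+ i + c%:~R * x ^+ n.+1) * c%:~R ^+ n = 0.
  by rewrite -[RHS](mul0r (c%:~R ^+ n)) -[in RHS]e /c lead_coefE E /= coef_map.
rewrite -[X in _ == X]e mulrDl addrC mulr_suml; apply/eqP; congr (_ + _).
  apply: eq_bigr => i _; rewrite !coef_map /= coef_poly ltn_ord rmorphM rmorphXn /= exprMn.
  have -> : (c%:~R ^+ n : K) = c%:~R ^+ (n - i) * c%:~R ^+ i by rewrite -exprD subnK // -ltnS.
  ring.
by rewrite exprMn exprS; ring.
Qed.

Lemma exists_common_denominator (K : fieldExtType rat) (xs : seq K) :
  exists2 d : nat, (0 < d)%N & forall x, x \in xs -> integralOver (intr : int -> K) (d%:R * x).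
Proof.
elim: xs => [|x xs [d d0 H]]; first by exists 1%N.
have [e e0 ex] := exists_denominator x; exists (d * e)%N; first by rewrite muln_gt0 d0.
move=> y; rewrite inE natrM => /predU1P[->|/H iy].
  by rewrite -mulrA; apply: intZ_M => //; apply: intZ_nat.
by rewrite mulrAC mulrC; apply: intZ_M => //; apply: intZ_nat.
Qed.

Lemma cvg0_small (R : realType) (u : nat -> R) (e : R) N :
  (u @ \oo --> (0 : R)) -> 0 < e -> exists2 M, (N <= M)%N & u M < e.
Proof.
move=> /cvgrPdist_lt/(_ e) H e0; have [k _ Hk] := H e0.
exists (N + k)%N; first exact: leq_addr.
have := Hk (N + k)%N (leq_addl _ _); rewrite /= sub0r normrN; apply: le_lt_trans.
exact: ler_norm.
Qed.

Section Growth.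
Variables (K : fieldExtType rat) (R : realType) (m : nat) (q : K).
Variables (a beta : 'I_m -> K) (beta0 : K).
Local Notation C := (R[i]).
Local Notation intK := (integralOver (intr : int -> K)).
Import Normc.
Hypotheses (q0 : q != 0).

Let S (N : nat) : K := beta0 + \sum_i beta i * tschakaloff_partial q (a i) N.

Hypothesis Scvg : forall v : K -> R, place_rep v -> 1 < v q -> (fun N : nat => v (S N)) @ \oo --> (0 : R).

Variable D : nat.
Hypotheses (D0 : (0 < D)%N) (Da : forall i, intK (D%:R * a i)) (Db : forall i, intK (D%:R * beta i)).
Hypothesis Db0 : intK (D%:R * beta0).

Definition wseq (N : nat) : K := D%:R ^+ N.+1 * q ^+ 'C(N, 2) * S N.

Let A i := D%:R * a i.
Let b i := D%:R * beta i.

Let DK : D%:R != 0 :> K. Proof. exact: natr_extQ_neq0. Qed.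

Lemma S_rec N : S N.+1 = S N + \sum_i beta i * ((q ^+ 'C(N, 2))^-1 * a i ^+ N).
Proof.
rewrite /S -addrA -big_split /=; congr (_ + _); apply: eq_bigr => i _.
by rewrite -mulrDr /tschakaloff_partial big_ord_recr.
Qed.

Lemma wseq_rec N : wseq N.+1 = D%:R * q ^+ N * (wseq N + \sum_i b i * A i ^+ N).
Proof.
rewrite /wseq S_rec binS bin1 exprD exprS.
rewrite [X in _ = _ * (_ + X)](_ : _ = D%:R ^+ N.+1 * q ^+ 'C(N, 2) *
   \sum_i beta i * ((q ^+ 'C(N, 2))^-1 * a i ^+ N)); last first.
  rewrite mulr_sumr; apply: eq_bigr => i _; rewrite /b /A exprMn exprS.
  by field; rewrite expf_neq0.
ring.
Qed.

Lemma wseq0 : wseq 0 = D%:R * beta0.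
Proof.
rewrite /wseq /S big1 => [|i _]; first by rewrite addr0 mulr1.
by rewrite /tschakaloff_partial big_ord0 mulr0.
Qed.

(* Iterated up to a large index [M], this bounds [wseq N] up to a multiple of [v (S M)],
   which tends to [0] at the places with [v q > 1]. *)
Lemma wseq_backward N : wseq N = (D%:R * q ^+ N)^-1 * wseq N.+1 - \sum_i b i * A i ^+ N.
Proof. by rewrite wseq_rec; field; rewrite DK expf_neq0. Qed.

Lemma place_of (v : K -> R) : absolute_value v -> 1 < v q -> place_rep v.
Proof.
move=> av v1; split=> //; exists q; rewrite (gt_eqF v1) (gt_eqF (lt_trans ltr01 v1)) //.
Qed.

(** The recurrence runs forwards if [v q <= 1] and backwards otherwise. A backward step divides by
    [D%:R * q ^+ k], of absolute value at least 1 once [D * c <= k], because [2 <= v q] and [v D%:R]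
    is at least [D] to the power -c; the threshold does not depend on [v]. *)
Lemma wseq_disc c (v : K -> R) N : disc_val c v -> (D * c <= N)%N -> v (wseq N) <= 1.
Proof.
move=> dv le; have [av ultra v2 vn] := dv.
have vA i : v (A i) <= 1 by exact: (disc_val_integral dv (Da i)).
have vb i : v (b i) <= 1 by exact: (disc_val_integral dv (Db i)).
have vD : v D%:R <= 1 by apply: av_nat_le1.
have ve k : v (\sum_i b i * A i ^+ k) <= 1.
  by apply: av_ultra_sum => // i _; apply: avM_le1 => //; apply: avX_le1.
have [vq|vq] := leP (v q) 1.
  elim: N {le} => [|k IH]; first by rewrite wseq0; exact: (disc_val_integral dv Db0).
  rewrite wseq_rec; apply: avM_le1 => //; last exact: av_ultra.
  by apply: avM_le1 => //; apply: avX_le1.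
have vDq k : (D * c <= k)%N -> 1 <= v (D%:R * q ^+ k).
  move=> lek; rewrite avM // avX //; apply: (le_trans (vn _ D0)); apply: ler_wpM2l; first exact: av_ge0.
  apply: (@le_trans _ _ (2 ^+ k)); last by apply: lerXn2r; rewrite ?nnegrE ?(av_ge0 av) // v2.
  apply: (@le_trans _ _ (2 ^+ (D * c))); last by rewrite ler_eXn2l ?ltr1n.
  rewrite exprM; apply: lerXn2r; rewrite ?nnegrE ?exprn_ge0 // -natrX ler_nat; exact/ltnW/ltn_expl.
have key j : v (wseq N) <= Num.max 1 (v (D%:R ^+ N.+1 * q ^+ 'C(N, 2)) * v (S (N + j)%N)).
  elim: j N le => [|j IH] N le; first by rewrite addn0 -avM // le_max lexx orbT.
  rewrite wseq_backward; apply: (le_trans (ultra _ _)).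
  rewrite avN // ge_max; apply/andP; split; last by rewrite le_max ve.
  have := IH N.+1 (leqW le); rewrite addSnnS => H.
  rewrite avM // avV // mulrC ler_pdivrMr; last exact: lt_le_trans (vDq _ le).
  apply: (le_trans H); rewrite ge_max; apply/andP; split.
    apply: (le_trans (vDq _ le)); rewrite ler_peMl ?av_ge0 //; by rewrite le_max lexx.
  rewrite binS bin1 exprD [D%:R ^+ N.+2]exprS.
  rewrite (_ : _ * (_ * _) = (D%:R * q ^+ N) * (D%:R ^+ N.+1 * q ^+ 'C(N, 2))); last by ring.
  rewrite [v (D%:R * q ^+ N * _)]avM // -mulrA mulrC ler_wpM2r ?av_ge0 //.
  by rewrite le_max lexx orbT.
rewrite leNgt; apply/negP => gt1.
have kpos : 0 < v (D%:R ^+ N.+1 * q ^+ 'C(N, 2)) by rewrite av_gt0 // mulf_neq0 ?expf_neq0.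
have [M NM small] := cvg0_small N (Scvg (place_of av vq) vq) (divr_gt0 ltr01 kpos).
have := key (M - N)%N; rewrite subnKC // le_max => /orP[|]; first by rewrite leNgt gt1.
by move=> le2; move: small; rewrite ltr_pdivlMr // mulrC => /(le_lt_trans le2)/(lt_trans gt1); rewrite ltxx.
Qed.

Variables (G rho : R) (N1 : nat).
Hypotheses (G1 : 1 <= G) (rho1 : 1 < rho).
Hypothesis GA : forall (s : {rmorphism K -> C}) i, normc (s (A i)) <= G.
Hypothesis Gb : forall (s : {rmorphism K -> C}) i, normc (s (b i)) <= G.
Hypothesis Gb0 : forall s : {rmorphism K -> C}, normc (s (D%:R * beta0)) <= G.
Hypothesis GD : D%:R <= G.
Hypothesis rho_gap : forall s : {rmorphism K -> C}, 1 < normc (s q) -> rho <= normc (s q).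
Hypothesis rhoN1 : 2 * G <= rho ^+ N1.

Lemma wseq_arch (s : {rmorphism K -> C}) N : (N1 <= N)%N ->
  normc (s (wseq N)) <= (2 * m.+1%:R * G) ^+ N.+1.
Proof.
move=> le; pose v x := normc (s x); have av : absolute_value v := absolute_value_normc s.
rewrite -/(v (wseq N)).
have G0 : 0 <= G by apply: le_trans G1.
set E := m%:R * G; have E0 : 0 <= E by rewrite mulr_ge0.
have ve k : v (\sum_i b i * A i ^+ k) <= E * G ^+ k.
  apply: (le_trans (av_le_sum av _ _ _)).
  apply: (@le_trans _ _ (\sum_(i < m) G * G ^+ k)); last first.
    by rewrite sumr_const card_ord -mulr_natl mulrA.
  apply: ler_sum => i _; rewrite avM // avX //.
  by apply: ler_pM; rewrite ?exprn_ge0 ?(av_ge0 av) // ?Gb // lerXn2r ?nnegrE ?(av_ge0 av) // GA.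
have vD : v D%:R = D%:R by rewrite /v rmorph_nat normc_nat.
set CC := 2 * m.+1%:R * G; have GC : G <= CC.
  by rewrite /CC ler_peMl // -natrM ler1n muln_gt0.
have [vq|vq] := leP (v q) 1.
  elim: N {le} => [|k IH].
    by rewrite wseq0 expr1; apply: le_trans GC; apply: Gb0.
  rewrite wseq_rec exprS avM //; apply: (@le_trans _ _ (G * (m.+1%:R * CC ^+ k.+1))).
    apply: ler_pM; rewrite ?(av_ge0 av) //.
      rewrite avM // vD avX // -[X in _ <= X]mulr1; apply: ler_pM => //.
        by rewrite exprn_ge0 // (av_ge0 av).
      by rewrite exprn_ile1 // (av_ge0 av).
    apply: (le_trans (av_leD av _ _)); rewrite -natr1 mulrDl mul1r addrC; apply: lerD => //.
    apply: (le_trans (ve _)); rewrite /E -mulrA -exprS; apply: ler_wpM2l; first exact: ler0n.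
    by apply: lerXn2r; rewrite ?nnegrE ?(le_trans G0 GC).
  rewrite mulrA; apply: ler_wpM2r; first by rewrite exprn_ge0 // (le_trans G0 GC).
  by rewrite /CC -mulrA [G * _]mulrC ler_peMl ?ler1n // mulr_ge0.
have vDq k : (N1 <= k)%N -> 2 * G <= v (D%:R * q ^+ k).
  move=> lek; rewrite avM // vD avX //; apply: (@le_trans _ _ (v q ^+ k)); last first.
    by rewrite ler_peMl ?exprn_ge0 ?(av_ge0 av) // ler1n.
  apply: (le_trans rhoN1); apply: (@le_trans _ _ (rho ^+ k)).
    by rewrite ler_eXn2l.
  by rewrite lerXn2r ?nnegrE ?(av_ge0 av) // ?(le_trans ler01 (ltW rho1)) //; apply: rho_gap.
(* A backward step divides by at least [2 * G]: the bound [2 * E * G ^+ N.+1] becomes [E * G ^+ N],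
   and the exponential sum adds another [E * G ^+ N]. *)
have key j : v (wseq N) <= 2 * E * G ^+ N + v (D%:R ^+ N.+1 * q ^+ 'C(N, 2)) * v (S (N + j)%N).
  elim: j N le => [|j IH] N le.
    by rewrite addn0 -avM // lerDr !mulr_ge0 // exprn_ge0.
  have pos : 0 < v (D%:R * q ^+ N).
    by apply: lt_le_trans (vDq _ le); rewrite mulr_gt0 // (lt_le_trans ltr01 G1).
  rewrite wseq_backward; apply: (le_trans (av_leD av _ _)); rewrite avN // avM // avV //.
  have := IH N.+1 (leqW le); rewrite addSnnS.
  rewrite binS bin1 exprD [D%:R ^+ N.+2]exprS.
  rewrite (_ : _ * (_ * _) = (D%:R * q ^+ N) * (D%:R ^+ N.+1 * q ^+ 'C(N, 2))); last by ring.
  rewrite [v (D%:R * q ^+ N * _)]avM //.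
  set x := v (D%:R * q ^+ N) in pos *; set y := v (_ * _); set z := v (S _); set t := v (wseq _) => H.
  have xG := vDq _ le; rewrite -/x in xG.
  have H1 : x^-1 * t <= x^-1 * (2 * E * G ^+ N.+1) + y * z.
    apply: (@le_trans _ _ (x^-1 * (2 * E * G ^+ N.+1 + x * y * z))).
      by rewrite ler_wpM2l // invr_ge0 ltW.
    by rewrite mulrDr -!mulrA mulKf ?gt_eqF.
  have H2 : x^-1 * (2 * E * G ^+ N.+1) <= E * G ^+ N.
    rewrite mulrC ler_pdivrMr // exprS.
    have -> : 2 * E * (G * G ^+ N) = E * G ^+ N * (2 * G) by ring.
    by rewrite ler_wpM2l // mulr_ge0 // exprn_ge0.
  have := ve N; lra.
have big : 2 * E * G ^+ N <= CC ^+ N.+1.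
  apply: (@le_trans _ _ (CC * G ^+ N)).
    rewrite ler_wpM2r ?exprn_ge0 // /CC /E mulrA ler_wpM2r // ler_wpM2l //.
    by rewrite ler_nat.
  by rewrite exprS ler_wpM2l ?(le_trans G0 GC) // lerXn2r ?nnegrE ?(le_trans G0 GC).
apply: (le_trans _ big); rewrite leNgt; apply/negP => gt1.
have kpos : 0 < v (D%:R ^+ N.+1 * q ^+ 'C(N, 2)) by rewrite av_gt0 // mulf_neq0 ?expf_neq0.
rewrite -subr_gt0 in gt1.
have [M NM small] := cvg0_small N (Scvg (place_of av vq) vq) (divr_gt0 gt1 kpos).
have := key (M - N)%N; rewrite subnKC //.
by move: small; rewrite ltr_pdivlMr // mulrC; lra.
Qed.

End Growth.

(** * Vanishing of the Hankel determinants *)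

(** If [y ^+ (2 ^ s)] is close to -1, its square is close to 1, and each further squaring multiplies
    the distance to 1 by at most 3. For fewer than [T] squarings the power stays within 1 of 1,
    hence away from -1. *)
Lemma bad_exponent_once (F : fieldType) (R : realType) (v : F -> R) (T : nat) (y : F) s t :
  absolute_value v -> v 2 = 2 -> (s < t)%N -> (t < s + T)%N ->
  v (1 + y ^+ (2 ^ s)) < 3^-1 ^+ T -> 3^-1 ^+ T <= v (1 + y ^+ (2 ^ t)).
Proof.
move=> av v2 st tT bad; rewrite leNgt; apply/negP => bad'.
set d : R := 3^-1 ^+ T in bad bad' *.
have T0 : (0 < T)%N by lia.
have d0 : 0 < d by rewrite exprn_gt0.
have d3 j : (j <= T)%N -> 3 ^+ j * d <= 1.
  move=> jT; rewrite /d -(subnKC jT) exprD exprVn mulVKf ?expf_neq0 //.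
  by rewrite exprn_ile1 // invr_le1 ?unitfE // ler1n.
have dle : d <= 3^-1.
  by have := d3 1%N T0; rewrite expr1 => H; rewrite -(ler_pM2l (_ : (0 : R) < 3)) // mulfV.
have sq (u : F) : u ^+ 2 - 1 = (u - 1) * (u + 1) by ring.
have key j : (j < T)%N -> v (y ^+ (2 ^ (s + j.+1)) - 1) < 3 ^+ j.+1 * d.
  elim: j => [_|j IH jT].
    rewrite addn1 expnSr exprM sq avM // expr1; set z := y ^+ _ in bad *.
    have : v (z - 1) <= v (1 + z) + v 2.
      have -> : z - 1 = (1 + z) + - 2 by ring.
      by rewrite -(avN av 2); apply: av_leD.
    rewrite v2 [1 + z]addrC in bad *; have := av_ge0 av (z - 1); have := av_ge0 av (z + 1).
    move: (v (z - 1)) (v (z + 1)) bad => p r; nra.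
  have H := IH (ltnW jT); rewrite (addnS s j.+1) expnSr exprM sq avM //; set u := y ^+ _ in H *.
  have : v (u + 1) <= v (u - 1) + v 2.
    have -> : u + 1 = (u - 1) + 2 by ring.
    exact: av_leD.
  have := d3 _ (ltnW jT); rewrite v2 [3 ^+ j.+2]exprS.
  have := av_ge0 av (u - 1); have := av_ge0 av (u + 1).
  move: (v (u - 1)) (v (u + 1)) (3 ^+ j.+1) H => p r w; nra.
have := key (t - s).-1 ltac:(lia); rewrite prednK ?subn_gt0 // subnKC ?(ltnW st) //.
have := d3 (t - s)%N ltac:(lia); set u := y ^+ _ in bad' *.
have : v 2 <= v (1 + u) + v (u - 1).
  have -> : 2 = (1 + u) + - (u - 1) by ring.
  by rewrite -(avN av (u - 1)); apply: av_leD.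
by rewrite v2; move: (v (u - 1)) (v (1 + u)) (_ ^+ _) bad' => p r w; lra.
Qed.

(** Each [y] spoils at most one element of [r]. *)
Lemma size_filter_all (X : eqType) (ys : seq X) (P : X -> nat -> bool) (r : seq nat) :
  uniq r -> (forall y, y \in ys -> {in r &, forall s t, P y s -> P y t -> s = t}) ->
  (size r <= size [seq s <- r | all (fun y => ~~ P y s) ys] + size ys)%N.
Proof.
elim: ys r => [|y ys IH] r ur H /=; first by rewrite filter_predT addn0.
have cnt : (count (P y) r <= 1)%N.
  rewrite -size_filter; have : uniq [seq s <- r | P y s] by apply: filter_uniq.
  case E : [seq s <- r | P y s] => [//|s [//|t l]] /=.
  have sr : s \in [seq s <- r | P y s] by rewrite E mem_head.
  have tr : t \in [seq s <- r | P y s] by rewrite E !inE eqxx orbT.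
  move: sr tr; rewrite !mem_filter => /andP[Ps sr] /andP[Pt tr].
  by rewrite (H y (mem_head _ _) s t sr tr Ps Pt) mem_head.
have := IH [seq s <- r | ~~ P y s] (filter_uniq _ ur) _.
rewrite -filter_predI (eq_filter (a1 := predI _ _)
  (a2 := fun s => ~~ P y s && all (fun y => ~~ P y s) ys)); last first.
  by move=> s /=; rewrite andbC.
rewrite size_filter; have := count_predC (P y) r.
rewrite (eq_count (a1 := predC _) (a2 := fun s => ~~ P y s)) // => e K.
have {}K := K _; rewrite addnS; suff : (count (fun s => ~~ P y s) r <=
    size [seq s <- r | ~~ P y s && all (fun y0 => ~~ P y0 s) ys] + size ys)%N by lia.
apply: K => z zys s t; rewrite !mem_filter => /andP[_ sr] /andP[_ tr].
by apply: (H z) => //; rewrite inE zys orbT.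
Qed.

(** With [sum_div_upper], this gives the exponent of [hankel_det_le] its order of magnitude M^2 /
    p. *)
Lemma sum_div_lower p M : (0 < p)%N -> (M * M.-1 <= 2 * p * \sum_(j < M) j %/ p + 2 * M * p)%N.
Proof.
move=> p0; elim: M => [|M IH] //; rewrite big_ord_recr /=.
have := ltn_ceil M p0; have : (M * M = M * M.-1 + M)%N by case: (M) => // k; nia.
move: (M * M.-1)%N (M %/ p)%N (\sum_(i < M) _)%N IH => u y x; nia.
Qed.

Lemma sum_div_upper p M : (0 < p)%N -> (p * \sum_(j < M) j %/ p <= M * M)%N.
Proof.
move=> p0; elim: M => [|M IH]; first by rewrite big_ord0 muln0.
rewrite big_ord_recr /= mulnDr; have := leq_trunc_div M p.
by move: (M %/ p)%N (\sum_(i < M) _)%N IH => y x; nia.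
Qed.

Lemma av_det_fact (F : fieldType) (R : realType) (v : F -> R) M (B : 'M[F]_M) (c : R) :
  absolute_value v -> (forall i j, v (B i j) <= c) -> v (\det B) <= M`!%:R * c ^+ M.
Proof.
move=> av H; apply: (le_trans (av_le_sum av _ _ _)).
apply: (@le_trans _ _ (\sum_(s : 'S_M) c ^+ M)).
  apply: ler_sum => s _; rewrite avM // avX // avN // av1 // expr1n mul1r av_prod //.
  rewrite -[X in c ^+ X]card_ord -prodr_const; apply: ler_prod => i _.
  by rewrite (av_ge0 av) H.
by rewrite sumr_const card_Sn mulr_natl.
Qed.

Lemma intZ_det (F : fieldType) M (B : 'M[F]_M) :
  (forall i j, integralOver (intr : int -> F) (B i j)) -> integralOver (intr : int -> F) (\det B).
Proof.
move=> H; rewrite /determinant; apply: (big_ind (integralOver (intr : int -> F))).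
- exact: (intZ_nat F 0).
- exact: intZ_D.
- move=> s _; apply: intZ_M; first by apply: intZ_X; apply: intZ_N; apply: (intZ_nat F 1).
  by apply: intZ_prod => i _.
Qed.

Lemma exists_exprn_ge (R : realType) (r x : R) : 1 < r -> exists n : nat, x <= r ^+ n.
Proof.
move=> r1; have bern n : 1 + (r - 1) * n%:R <= r ^+ n.
  elim: n => [|n IH]; first by rewrite mulr0 addr0.
  rewrite -natr1 exprS; have n0 : 0 <= n%:R :> R by [].
  have := ler_wpM2l (ltW (lt_trans ltr01 r1)) IH.
  have : 0 <= (r - 1) ^+ 2 * n%:R by rewrite mulr_ge0 // sqr_ge0.
  by move: (n%:R) (r ^+ n) => k e; nra.
exists (Num.truncn (`|x| / (r - 1))).+1; apply: le_trans (bern _).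
have r0 : 0 < r - 1 by lra.
have := truncnS_gt (`|x| / (r - 1)); rewrite ltr_pdivrMr // mulrC => H.
by apply: (le_trans (ler_norm x)); lra.
Qed.

(** * Dividing by the numbers [1 + q ^+ (2 ^ s)] simultaneously *)

Section DivisibleHankel.
Variables (K : fieldType) (R : realType) (c : nat) (v : K -> R) (q H : K) (S : seq nat) (e : nat -> nat).
Hypotheses (dv : disc_val c v) (uS : uniq S).
Hypothesis A0 : forall s, 1 + q ^+ (2 ^ s) != 0.
Hypotheses (vH : v H <= 1).
Hypothesis vHA : forall s, s \in S -> v q <= 1 -> v H ^+ 2 <= v (1 + q ^+ (2 ^ s)) ^+ e s.

Let av : absolute_value v. Proof. by case: dv. Qed.
Let ultra x y : v (x + y) <= Num.max (v x) (v y). Proof. by case: dv. Qed.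

(** [1 + q ^+ (2 ^ s)] divides [q ^+ (2 ^ s.+1) - 1], which divides [q ^+ (2 ^ t) - 1]. *)
Lemma pow2_congr s t : v q <= 1 -> (s < t)%N -> v (q ^+ (2 ^ t) - 1) <= v (1 + q ^+ (2 ^ s)).
Proof.
move=> vq; elim: t => // t IH; rewrite ltnS leq_eqVlt expnSr exprM.
have -> : (q ^+ (2 ^ t)) ^+ 2 - 1 = (1 + q ^+ (2 ^ t)) * (q ^+ (2 ^ t) - 1) by ring.
have v1 : v 1 <= 1 by rewrite av1.
have vp k : v (q ^+ k) <= 1 by apply: avX_le1.
case/predU1P => [<-|/IH le]; rewrite avM //.
  by rewrite ler_piMr ?av_ge0 //; apply: av_ultraB.
apply: le_trans le; rewrite ler_piMl ?av_ge0 //; exact: av_ultra.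
Qed.

(* [1 + q^(2^t)] is congruent to [2] modulo [1 + q^(2^s)] for [s < t], so that at most one
   of these numbers is divisible by more than [2] at [v]. *)
Lemma val_quotient_le1 : v (H ^+ 2 * \prod_(s <- S) (2 / (1 + q ^+ (2 ^ s))) ^+ e s) <= 1.
Proof.
pose A s := 1 + q ^+ (2 ^ s).
have pos s : 0 < v (A s) by rewrite (av_gt0 av); exact: A0.
have fac s : v 2 <= v (A s) -> v ((2 / A s) ^+ e s) <= 1.
  by move=> le; apply: avX_le1 => //; rewrite avM // avV // ler_pdivrMr // mul1r.
have v2 : v 2 <= 1 by apply: (av_nat_le1 av ultra 2).
have [[s sS lt]|all] := pselect (exists2 s, s \in S & v (A s) < v 2); last first.
  apply: avM_le1 => //; first exact: avX_le1.
  rewrite av_prod // big_seq; apply: prodr_ile1 => s sS; apply/andP; split; first exact: av_ge0.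
  by apply: fac; rewrite leNgt; apply/negP => lt; apply: all; exists s.
have vq : v q <= 1.
  rewrite leNgt; apply/negP => gt.
  have : v (q ^+ (2 ^ s)) <= 1.
    have -> : q ^+ (2 ^ s) = A s - 1 by rewrite /A; ring.
    by apply: av_ultraB; rewrite ?av1 // ltW // (lt_le_trans lt).
  by rewrite leNgt avX // exprn_egt1 // expn_eq0.
have other t u : (t < u)%N -> v (A t) < v 2 -> v 2 <= v (A u).
  move=> tu lt2; have -> : v 2 = v (A u - (q ^+ (2 ^ u) - 1)) by congr v; rewrite /A; ring.
  have := ultra (A u) (- (q ^+ (2 ^ u) - 1)); rewrite le_max => /orP[//|le]; exfalso.
  have E : A u - (q ^+ (2 ^ u) - 1) = 2 by rewrite /A; ring.
  move: le; rewrite E avN // => le; have := le_lt_trans (le_trans le (pow2_congr vq tu)) lt2.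
  by rewrite ltxx.
(* The determinant pays for the one exponent [s] with [v (A s) < v 2]; the 2 in the numerator pays
   for the others. *)
rewrite (big_rem s) //= mulrA; apply: avM_le1 => //.
  rewrite avM // avX //; apply: (@le_trans _ _ (v (A s) ^+ e s * v ((2 / A s) ^+ e s))).
    by rewrite ler_wpM2r ?av_ge0 // vHA.
  by rewrite -avX // -avM // -exprMn [A s * _]mulrC divfK ?A0 //; apply: (avX_le1 av).
rewrite av_prod // big_seq; apply: prodr_ile1 => t tr; apply/andP; split; first exact: av_ge0.
move: tr; rewrite mem_rem_uniq // inE => /andP[ts tS].
apply: fac; case: (ltngtP s t) ts => // [st|ts] _; first exact: other st lt.
rewrite leNgt; apply/negP => lt'.
by have := other _ _ ts lt'; rewrite leNgt lt.
Qed.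

End DivisibleHankel.

Lemma sum_div_quadratic M p e : (4 * p + 2 <= M)%N -> (M * M.-1 <= 2 * p * e + 2 * M * p)%N ->
  (M * M <= 4 * p * e)%N.
Proof.
have : (M * M = M * M.-1 + M)%N by case: M => // k; nia.
by move: (M * M.-1)%N => u; nia.
Qed.

Section Assembly.
Variables (K : fieldExtType rat) (R : realType) (m : nat) (q : K).
Local Notation C := (R[i]).
Local Notation n := (\dim {:K}).
Local Notation intK := (integralOver (intr : int -> K)).
Import Normc.

Lemma absolute_value_normC : absolute_value (fun z : C => normc z).
Proof.
split=> [z|z|z t|z t]; rewrite ?normc_ge0 ?normcM //; last exact: le_normcD.
by apply/eqP/eqP => [/eq0_normc|->]; rewrite ?normc0.
Qed.

Lemma exists_arch_bound (xs : seq K) : exists2 G : R, 1 <= G &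
  forall x (s : {rmorphism K -> C}), x \in xs -> normc (s x) <= G.
Proof.
have bnd (ys : seq C) : exists g : R, forall y, y \in ys -> normc y <= g.
  elim: ys => [|y ys [g H]]; first by exists 0.
  exists (Num.max (normc y) g) => z; rewrite inE le_max => /predU1P[->|/H ->].
    by rewrite lexx.
  by rewrite orbT.
elim: xs => [|x xs [G G1 H]]; first by exists 1.
have [ys [_ _ _ H2]] := conjugates R x; have [g Hg] := bnd ys.
exists (Num.max g G); first by rewrite le_max G1 orbT.
move=> z s; rewrite inE le_max => /predU1P[->|/(H _ s) ->]; last by rewrite orbT.
by rewrite Hg.
Qed.

Lemma exists_gap : exists2 rho : R, 1 < rho &
  forall s : {rmorphism K -> C}, 1 < normc (s q) -> rho <= normc (s q).
Proof.
have gap (ys : seq C) : exists2 rho : R, 1 < rho & forall y, y \in ys -> 1 < normc y -> rho <= normc y.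
  elim: ys => [|y ys [r r1 H]]; first by exists 2 => //; rewrite ltr1n.
  have [y1|y1] := ltP 1 (normc y).
    exists (Num.min r (normc y)) => [|z]; first by rewrite lt_min r1.
    rewrite inE ge_min => /predU1P[->|zy z1]; first by rewrite lexx orbT.
    by rewrite H.
  by exists r => // z; rewrite inE => /predU1P[->|/H//]; rewrite ltNge y1.
have [ys [_ _ _ H2]] := conjugates R q; have [r r1 H] := gap ys.
by exists r => // s; apply: H.
Qed.

(** Each of the [n] conjugates of [q] excludes at most one exponent from a window of length [L + n].
    [T] is chosen before [s0], so that the window may start as far out as [T] requires. *)
Lemma exists_good_exponents (L : nat) : exists T : nat, forall s0 : nat, exists S : seq nat,
  [/\ uniq S, (L <= size S)%N, (size S <= T)%N, forall s, s \in S -> (s0 <= s < s0 + T)%N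
    & forall s (f : {rmorphism K -> C}), s \in S -> 3^-1 ^+ T <= normc (f (1 + q ^+ (2 ^ s)))].
Proof.
have [ys [sz _ _ H2]] := conjugates R q.
exists (L + n)%N => s0; set T := (L + n)%N.
pose P (y : C) s := normc (1 + y ^+ (2 ^ s)) < 3^-1 ^+ T.
exists [seq s <- iota s0 T | all (fun y => ~~ P y s) ys]; split.
- by rewrite filter_uniq // iota_uniq.
- have := @size_filter_all _ ys P (iota s0 T) (iota_uniq _ _).
  rewrite size_iota sz /T leq_add2r; apply=> y yys s t.
  rewrite !mem_iota => /andP[s1 s2] /andP[t1 t2]; rewrite /P => Ps Pt.
  have two : normc (2 : C) = 2 by exact: normc_nat 2.
  have B u w := @bad_exponent_once _ _ _ T y u w absolute_value_normC two.
  case: (ltngtP s t) => // lt.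
    by have := B _ _ lt (ltac:(lia)) Ps; rewrite leNgt Pt.
  by have := B _ _ lt (ltac:(lia)) Pt; rewrite leNgt Ps.
- by rewrite size_filter (leq_trans (count_size _ _)) // size_iota.
- by move=> s; rewrite mem_filter mem_iota => /andP[].
- move=> s f; rewrite mem_filter => /andP[/allP/(_ _ (H2 f)) + _].
  by rewrite /P -leNgt rmorphD rmorph1 rmorphXn.
Qed.

Variables (a beta : 'I_m -> K) (beta0 : K).
Hypotheses (q0 : q != 0) (qroot : forall k : nat, (0 < k)%N -> q ^+ k != 1).
Hypothesis Scvg : forall v : K -> R, place_rep v -> 1 < v q ->
  (fun N : nat => v (beta0 + \sum_i beta i * tschakaloff_partial q (a i) N)) @ \oo --> (0 : R).
Variable D : nat.
Hypotheses (D0 : (0 < D)%N) (Da : forall i, intK (D%:R * a i)) (Db : forall i, intK (D%:R * beta i)).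
Hypothesis Db0 : intK (D%:R * beta0).

Local Notation w := (wseq q a beta beta0 D).

Lemma integral_of_disc (x : K) : (forall v : K -> R, disc_val n`! v -> v x <= 1) -> intK x.
Proof.
move=> H; apply: contrapT => /(@exists_disc_val K R)[v dv]; rewrite ltNge.
by rewrite H.
Qed.

Lemma wseq_growth : exists N0 : nat, exists2 c : R, 1 <= c &
  forall N, (N0 <= N)%N -> intK (w N) /\ forall s : {rmorphism K -> C}, normc (s (w N)) <= c ^+ N.+1.
Proof.
have [G G1 HG] := exists_arch_bound ([:: D%:R; D%:R * beta0] ++
  ([seq D%:R * a i | i : 'I_m] ++ [seq D%:R * beta i | i : 'I_m])).
have [rho rho1 gap] := exists_gap.
have [N1 hN1] := exists_exprn_ge (2 * (G + D%:R)) rho1.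
have G1' : 1 <= G + D%:R by rewrite (le_trans G1) // lerDl.
exists (N1 + D * n`!)%N, (2 * m.+1%:R * (G + D%:R)).
  by apply: (le_trans G1'); rewrite ler_peMl ?(le_trans ler01 G1') // -natrM ler1n.
move=> N le; split.
  apply: integral_of_disc => v dv; apply: (wseq_disc q0 Scvg D0 Da Db Db0 dv).
  by apply: leq_trans le; apply: leq_addl.
have GG x (s : {rmorphism K -> C}) : x \in [:: D%:R; D%:R * beta0] ++
  ([seq D%:R * a i | i : 'I_m] ++ [seq D%:R * beta i | i : 'I_m]) -> normc (s x) <= G + D%:R.
  by move=> /(HG _ s) H; apply: (le_trans H); rewrite lerDl.
move=> s; apply: (wseq_arch q0 Scvg D0 G1' rho1 _ _ _ _ gap hN1) => [f i|f i|f||].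
- apply: GG; rewrite !mem_cat; apply/orP; right; apply/orP; left.
  by apply/mapP; exists i; rewrite ?mem_enum.
- apply: GG; rewrite !mem_cat; apply/orP; right; apply/orP; right.
  by apply/mapP; exists i; rewrite ?mem_enum.
- by apply: GG; rewrite !mem_cat !inE eqxx orbT.
- by rewrite lerDr (le_trans ler01 G1).
- by apply: leq_trans le; apply: leq_addr.
Qed.

Local Notation hankel N0 M := (\det (\matrix_(i < M, j < M) w (N0 + (i + j))%N)).

Lemma hankel_arch (N0 : nat) (c : R) M (s : {rmorphism K -> C}) : 1 <= c -> (N0 <= M)%N ->
  (forall N, (N0 <= N)%N -> normc (s (w N)) <= c ^+ N.+1) ->
  normc (s (hankel N0 M)) <= (2 * c ^+ 3) ^+ (M * M).
Proof.
move=> c1 NM H; have c0 : 0 <= c := le_trans ler01 c1.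
(* As [N0 <= M], the exponents [N0 + i + j + 1] stay below [3 * M]; the factorial of [M] is at most
   [2 ^ (M * M)]. *)
have := @av_det_fact _ _ _ M (\matrix_(i < M, j < M) w (N0 + (i + j))%N) (c ^+ (3 * M))
  (absolute_value_normc s) _.
move=> B; apply: le_trans (B _) _ => [i j|].
  rewrite mxE; apply: (le_trans (H _ (leq_addr _ _))); apply: ler_weXn2l => //.
  by have := ltn_ord i; have := ltn_ord j; lia.
rewrite exprMn; apply: ler_pM; rewrite ?exprn_ge0 //.
  rewrite -natrX ler_nat expnM; apply: (@leq_trans (M ^ M)).
    elim: (M) => // k IH; rewrite factS expnS leq_mul // (leq_trans IH) //.
    by case: k {IH} => // k; rewrite leq_exp2r.
  by case: (M) => // k; rewrite leq_exp2r //; apply/ltnW/ltn_expl.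
by rewrite -!exprM mulnA.
Qed.

Lemma hankel_vanish : exists N0 M1 : nat, forall M, (M1 <= M)%N -> hankel N0 M = 0.
Proof.
have [N0 [c c1 Hw]] := wseq_growth.
have [v0 [kappa [av0 lio v0B] v0q]] := exists_good_place R q0 qroot.
have c0 : 0 <= c := le_trans ler01 c1.
(* Bases of bounds to the power [M * M]: [Q] for the conjugates of the determinant, [Q2] for those
   of [x] below, which squares the determinant and loses a further 2 in the product over [S]. *)
pose Q := 2 * c ^+ 3; pose Q2 := 2 * Q ^+ 2.
have Q1 : 1 <= Q.
  by rewrite /Q -[X in X <= _]mulr1; apply: ler_pM; rewrite ?ler1n // exprn_ege1.
have Q21 : 1 <= Q2.
  by rewrite /Q2 -[X in X <= _]mulr1; apply: ler_pM; rewrite ?ler1n // exprn_ege1.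
have Q20 : 0 <= Q2 := le_trans ler01 Q21.
pose g := m.+1.
(* The exponent is the one reached in [big]: [kappa.+1] from [YB], and 16 as the 8 of [e_low]
   doubled by the square in [A2]. *)
have [L hL] := exists_exprn_ge (Q2 ^+ (kappa.+1 * (16 * g)) + 1) v0q.
have [T HT] := exists_good_exponents L.
have [k3 hk3] := exists_exprn_ge 3 v0q.
(* [T * T.*2.+1 <= 2 ^ s0] yields [EM], and [k3] yields [3 <= v0 q ^+ (2 ^ s)], used in [A2]. *)
pose s0 := (T * T.*2.+1 + k3)%N.
have [S [uS LS ST rS gS]] := HT s0.
exists N0, (N0 + (4 * (2 ^ (s0 + T).+1 * g) + 2))%N => M leM; apply/eqP/negPn/negP => H0.
set H := hankel N0 M in H0.
have intH : intK H.
  by apply: intZ_det => i j; rewrite mxE; apply: (Hw _ (leq_addr _ _)).1.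
have archH (s : {rmorphism K -> C}) : normc (s H) <= Q ^+ (M * M).
  by apply: hankel_arch => // [|N le]; [apply: leq_trans leM; apply: leq_addr|apply: (Hw _ le).2].
pose A s := 1 + q ^+ (2 ^ s).
have A0 s : A s != 0.
  rewrite /A addrC addr_eq0; apply/eqP => e.
  have := qroot (_ : 0 < 2 ^ s.+1)%N; rewrite expn_gt0 /= => /(_ isT).
  by rewrite expnSr exprM e sqrrN expr1n eqxx.
pose p s := (2 ^ s.+1 * m.+1)%N.
have p0 s : (0 < p s)%N by rewrite muln_gt0 expn_gt0.
pose e s := (\sum_(j < M) j %/ p s)%N.
(* The powers of 2 make up for the [A s] being coprime only up to 2; the square comes from
   [hankel_det_le]. *)
pose x := H ^+ 2 * \prod_(s <- S) (2 / A s) ^+ e s.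
have two0 : (2 : K) != 0 by apply: (@natr_extQ_neq0 K 2).
have x0 : x != 0.
  rewrite mulf_neq0 ?expf_neq0 //; rewrite prodf_seq_neq0; apply/allP => s _ /=.
  by apply: expf_neq0; apply: mulf_neq0 => //; rewrite invr_eq0; exact: A0.
have intx : intK x.
  apply: integral_of_disc => v dv; have [av ultra _ _] := dv.
  apply: (val_quotient_le1 dv uS) => // [|s sS vq]; first exact: (disc_val_integral dv intH).
  have v1 : v 1 <= 1 by rewrite av1.
  have vX : v (q ^+ (2 ^ s)) <= 1 by apply: avX_le1.
  apply: (@hankel_det_le K R v av ultra q D%:R (A s) (q ^+ (2 ^ s) - 1) (2 ^ s.+1) m
    (fun i => D%:R * a i) (fun i => D%:R * beta i) w N0) => //.
  - by rewrite expn_gt0.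
  - by rewrite /A expnSr exprM; ring.
  - exact: av_nat_le1.
  - exact: av_ultra.
  - exact: av_ultraB.
  - by move=> i; exact: (disc_val_integral dv (Da i)).
  - by move=> i; exact: (disc_val_integral dv (Db i)).
  - by move=> N _; apply: wseq_rec.
  - by move=> N le; exact: (disc_val_integral dv (Hw _ le).1).
pose E := (\sum_(s <- S) e s)%N.
have e_up s : s \in S -> (2 ^ s0 * e s <= M * M)%N.
  move=> /rS/andP[s0s _]; apply: leq_trans (sum_div_upper M (p0 s)).
  rewrite leq_mul2r /p; apply/orP; right; apply: (@leq_trans (2 ^ s.+1)).
    by rewrite leq_exp2l // (leq_trans s0s).
  by rewrite leq_pmulr.
have EM : (E * T.*2.+1 <= M * M)%N.
  have h1 : (2 ^ s0 * E <= T * (M * M))%N.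
    apply: (@leq_trans (size S * (M * M))); last by rewrite leq_mul2r ST orbT.
    rewrite /E big_distrr /= -sum1_size big_distrl /= big_seq [X in (_ <= X)%N]big_seq.
    by apply: leq_sum => s sS; rewrite mul1n; apply: e_up.
  have h2 : (T * T.*2.+1 <= 2 ^ s0)%N.
    by apply: (@leq_trans s0); [exact: leq_addr|apply/ltnW/ltn_expl].
  rewrite -(@leq_pmul2l (2 ^ s0)) ?expn_gt0 // mulnA.
  apply: (@leq_trans (T * (M * M) * T.*2.+1)); first by rewrite leq_mul2r h1 orbT.
  by rewrite mulnAC leq_mul2r h2 orbT.
have e_low s : s \in S -> (M * M <= 8 * g * (2 ^ s * e s))%N.
  move=> sS; have /andP[_ sT] := rS _ sS.
  have := sum_div_lower M (p0 s); rewrite -/(e s) => h.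
  have pM : (4 * p s + 2 <= M)%N.
    apply: (@leq_trans (4 * (2 ^ (s0 + T).+1 * g) + 2)); last by apply: leq_trans leM; apply: leq_addl.
    by rewrite leq_add2r leq_mul2l leq_mul2r leq_exp2l // ltnS (ltnW sT) !orbT.
  have -> : (8 * g * (2 ^ s * e s) = 4 * p s * e s)%N by rewrite /p /g expnS; ring.
  exact: sum_div_quadratic pM h.
have M0 : (0 < M * M)%N by rewrite muln_gt0 andbb; apply: leq_trans leM; rewrite addnA addn2.
pose B := Q2 ^+ (M * M).
have B1 : 1 <= B by rewrite exprn_ege1.
have BE : B = (Q ^+ (M * M)) ^+ 2 * 2 ^+ (M * M) by rewrite /B /Q2 exprMn exprAC mulrC.
have archx (s : {rmorphism K -> C}) : normc (s x) <= B.
  pose v z := normc (s z); have av : absolute_value v := absolute_value_normc s.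
  rewrite -/(v x) /x avM // BE; apply: ler_pM; rewrite ?(av_ge0 av) //.
    by rewrite avX // lerXn2r ?nnegrE ?(av_ge0 av) ?exprn_ge0 ?(le_trans ler01 Q1) //; apply: archH.
  (* Each [2 / A t] has conjugates at most 2 * 3^T <= 2^(2T + 1), and [EM] keeps the total within
     2^(M^2). *)
  apply: (@le_trans _ _ (2 ^+ (T.*2.+1 * E))); last by rewrite ler_eXn2l ?ltr1n // mulnC.
  rewrite av_prod // exprM /E expr_sum big_seq [X in _ <= X]big_seq; apply: ler_prod => t tS.
  rewrite (av_ge0 av) avX //= lerXn2r ?nnegrE ?(av_ge0 av) ?exprn_ge0 //.
  have d0 : (0 : R) < 3^-1 ^+ T by rewrite exprn_gt0.
  have vA : 3^-1 ^+ T <= v (A t) by apply: gS.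
  rewrite avM // avV // ler_pdivrMr ?(lt_le_trans d0 vA) //.
  have -> : v 2 = 2 by rewrite /v rmorph_nat; exact: normc_nat 2.
  apply: (@le_trans _ _ (2 ^+ T.*2.+1 * 3^-1 ^+ T)); last by rewrite ler_wpM2l ?exprn_ge0.
  rewrite exprS -mul2n exprM -mulrA -exprMn ler_peMr // exprn_ege1 //.
  by rewrite ler_pdivlMr // mul1r expr2; lra.
pose Y := \prod_(s <- S) v0 (A s) ^+ e s.
have Y0 : 0 < Y by apply: prodr_gt0 => s _; rewrite exprn_gt0 // av_gt0.
have v02 : v0 2 <= 2.
  by have := av_leD av0 1 1; rewrite av1.
have xY : v0 x * Y <= B.
  have -> : v0 x * Y = v0 H ^+ 2 * v0 2 ^+ E.
    rewrite /x avM // avX // -mulrA; congr (_ * _).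
    rewrite (av_prod av0) /Y /E expr_sum -big_split /=; apply: eq_bigr => s _.
    by rewrite -avX // -avM // -exprMn divfK // avX.
  rewrite BE; apply: ler_pM; rewrite ?exprn_ge0 ?(av_ge0 av0) //.
    rewrite lerXn2r ?nnegrE ?(av_ge0 av0) ?exprn_ge0 ?(le_trans ler01 Q1) //.
    by apply: v0B => //; rewrite exprn_ege1.
  apply: (@le_trans _ _ (2 ^+ E)); first by rewrite lerXn2r ?nnegrE ?(av_ge0 av0).
  by rewrite ler_eXn2l ?ltr1n // (leq_trans _ EM) // leq_pmulr.
(* The Liouville inequality bounds [v0 x] from below, [xY] bounds [v0 x * Y] from above. *)
have YB : Y <= B ^+ kappa.+1.
  have l1 := lio x B B1 intx x0 archx.
  apply: (@le_trans _ _ (v0 x * B ^+ kappa * Y)); first by rewrite ler_peMl // ltW.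
  by rewrite mulrAC exprS ler_wpM2r // exprn_ge0 // (le_trans ler01 B1).
have r0 : 0 <= v0 q by apply: av_ge0.
(* [v0 (A s)] is at least r - 1 with r = [v0 q ^+ (2 ^ s)], and r <= (r - 1)^2 for r >= 3. *)
have A2 s : s \in S -> v0 q ^+ (2 ^ s) <= v0 (A s) ^+ 2.
  move=> /rS/andP[s0s _].
  have r3 : 3 <= v0 q ^+ (2 ^ s).
    apply: (le_trans hk3); rewrite ler_eXn2l //.
    apply: (@leq_trans s0); first exact: leq_addl.
    by apply: (leq_trans s0s); apply/ltnW/ltn_expl.
  have : v0 q ^+ (2 ^ s) <= v0 (A s) + 1.
    rewrite -avX // -[X in _ <= _ + X](av1 av0) -(avN av0 1).
    have {1}-> : q ^+ (2 ^ s) = A s + -1 by rewrite /A; ring.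
    exact: av_leD.
  by move: (v0 q ^+ _) (v0 (A s)) r3 => r t; nra.
have Y2 : v0 q ^+ (\sum_(s <- S) 2 ^ s * e s)%N <= Y ^+ 2.
  rewrite /Y -prodrXl expr_sum big_seq [X in _ <= X]big_seq; apply: ler_prod => s sS.
  apply/andP; split; first exact: exprn_ge0.
  rewrite exprM [X in _ <= X]exprAC; apply: lerXn2r; rewrite ?nnegrE ?exprn_ge0 ?(av_ge0 av0) //.
  exact: A2.
(* By [e_low] each [s] contributes at least [M * M] to the exponent, whatever its size. *)
have big : v0 q ^+ (L * (M * M)) <= B ^+ (kappa.+1 * (16 * g)).
  apply: (@le_trans _ _ (v0 q ^+ (8 * g * \sum_(s <- S) 2 ^ s * e s)%N)).
    rewrite ler_eXn2l // big_distrr /=; apply: (@leq_trans (size S * (M * M))).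
      by rewrite leq_mul2r LS orbT.
    rewrite -sum1_size big_distrl /= big_seq [X in (_ <= X)%N]big_seq.
    by apply: leq_sum => s sS; rewrite mul1n; apply: e_low.
  rewrite mulnC exprM; apply: (@le_trans _ _ ((Y ^+ 2) ^+ (8 * g))).
    by rewrite lerXn2r ?nnegrE ?exprn_ge0 // ltW.
  rewrite -exprM mulnA -[(2 * 8)%N]/16%N.
  rewrite [X in _ <= X]exprM lerXn2r ?nnegrE ?(ltW Y0) ?exprn_ge0 //.
have {}big : (v0 q ^+ L) ^+ (M * M) <= (Q2 ^+ (kappa.+1 * (16 * g))) ^+ (M * M).
  by move: big; rewrite /B -!exprM [(M * M * _)%N]mulnC.
rewrite ler_pXn2r ?nnegrE ?exprn_ge0 // in big.
by have := le_trans hL big; rewrite gerDl ler10.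
Qed.

Hypotheses (a0 : forall i, a i != 0).
Hypothesis aclass : forall i j : 'I_m, i != j -> forall k : int, a i != a j * q ^ k.

Lemma beta_eq0 i : beta i = 0.
Proof.
have DK : D%:R != 0 :> K by apply: natr_extQ_neq0.
have [N0 [M1 H]] := hankel_vanish.
have [P P0 kP] := @recurrence_of_hankel K M1 (fun N => w (N0 + N)%N) H.
have : D%:R * beta i = 0.
  apply: (@qrec_rational K q D%:R m (fun i => D%:R * a i) (fun i => D%:R * beta i) w 0) => //.
  - by move=> j; rewrite mulf_neq0.
  - by move=> j l jl k; rewrite -mulrA (inj_eq (mulfI DK)); apply: aclass.
  - by move=> N _; apply: wseq_rec.
  exists P => //; exists N0 => N le; rewrite -(kP (N - N0)%N) -{1}(subnKC le).
  by apply: eq_bigr => j _; rewrite addnA.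
by move/eqP; rewrite mulf_eq0 (negPf DK) => /eqP.
Qed.

(** Once the [beta i] vanish the sums are constant, and a place with [1 < v0 q] exists to see that
    the constant is 0. *)
Lemma beta0_eq0 : beta0 = 0.
Proof.
have [v0 [kappa [av0 _ _] v0q]] := exists_good_place R q0 qroot.
apply/eqP; rewrite -(av_eq0 av0); apply: contraT => nz.
have pos : 0 < v0 beta0 by rewrite lt0r nz av_ge0.
have [M _] := cvg0_small 0 (Scvg (place_of av0 v0q) v0q) pos.
rewrite big1 ?addr0 ?ltxx // => i _; by rewrite beta_eq0 mul0r.
Qed.

End Assembly.

Theorem theorem4p4p1 (R : realType) (K : fieldExtType rat) (m : nat)
    (q xi : K) (alpha : 'I_m -> K) (beta0 : K) (beta : 'I_m -> K) :
  q != 0 -> xi != 0 -> (forall i, alpha i != 0) ->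
  (forall n : nat, (0 < n)%N -> q ^+ n != 1) ->
  (forall i j : 'I_m, i != j -> forall k : int, alpha i != alpha j * q ^ k) ->
  (forall v : K -> R, place_rep v -> 1 < v q ->
     (fun N : nat => v (tsch_comb_partial q beta0 beta alpha xi N)) @ \oo --> 0) ->
  beta0 = 0 /\ (forall i, beta i = 0).
Proof.
move=> q0 xi0 alpha0 qroot aclass cvg.
(* [xi] is absorbed into the [alpha i]: a common nonzero factor keeps their classes modulo powers of
   [q] distinct. *)
pose a i := alpha i * xi.
have a0 i : a i != 0 by rewrite mulf_neq0.
have acl i j : i != j -> forall k : int, a i != a j * q ^ k.
  by move=> ij k; rewrite /a mulrAC (inj_eq (mulIf xi0)) aclass.
have [D D0 HD] := exists_common_denominator
  (beta0 :: [seq a i | i : 'I_m] ++ [seq beta i | i : 'I_m]).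
have Da i : integralOver (intr : int -> K) (D%:R * a i).
  apply: HD; rewrite inE mem_cat; apply/orP; right; apply/orP; left.
  by apply/mapP; exists i; rewrite ?mem_enum.
have Db i : integralOver (intr : int -> K) (D%:R * beta i).
  apply: HD; rewrite inE mem_cat; apply/orP; right; apply/orP; right.
  by apply/mapP; exists i; rewrite ?mem_enum.
have Db0 : integralOver (intr : int -> K) (D%:R * beta0) by apply: HD; rewrite mem_head.
split=> [|i].
  exact: (beta0_eq0 q0 qroot cvg D0 Da Db Db0 a0 acl).
exact: (beta_eq0 q0 qroot cvg D0 Da Db Db0 a0 acl).
Qed.
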